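(* Let $G_0$ be a fixed graph with at least one edge, let $p\in[0,1]$ (which may depend on $n$) and $q:=1-p$, and let $W$ be the number of subgraphs of the Erdős–Rényi random graph $\mathbf G(n,p)$ that are isomorphic to $G_0$. Put $$F:=\frac{W-\mathbb E[W]}{\sqrt{\operatorname{Var}(W)}},\qquad \Psi:=\min_{H\subset G_0,\ e_H\ge1}\bigl\{n^{v_H}p^{e_H}\bigr\}.$$ Then, for $k\in\mathbb N$ and $z\in\mathbb R$, $$|\mathbb P(F\le z)-\Phi(z)|\le\frac C{(1+|z|)^k}\,O\bigl((q\Psi)^{-\frac12}\bigr),$$ and $C$ is a constant depending on $k\in\mathbb N$ and on $G_0$.
   Context: $\mathbf G(n,p)$ is obtained from the complete graph on $n$ vertices by keeping each edge with probability $p$ and removing it with probability $q=1-p$, independently for all edges. The minimum in $\Psi$ runs over the subgraphs $H$ of $G_0$ with at least one edge; $v_H$ and $e_H$ denote the numbers of vertices and edges of $H$. $\Phi$ is the distribution function of $\mathcal N(0,1)$.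
   Formalization: For k ≥ 4 the bound is proved only where qΨ ≥ c, for any fixed c > 0, with C depending also on c (it fails as qΨ → 0, e.g. one possible edge and p → 0); for k ≤ 3 it holds for all p with C depending on k and G_0. Var(W) > 0 is assumed so that F is defined. *)

(* Defs.v *)
From mathcomp Require Import all_boot all_order all_algebra.
From mathcomp Require Import all_classical all_reals all_analysis.

Set Implicit Arguments.
Unset Strict Implicit.
Unset Printing Implicit Defensive.

Import Order.TTheory GRing.Theory Num.Theory.

Local Open Scope ring_scope.

(* A graph with vertices in the finite type T is a pair (vertex set, edge set),
   an edge being an unordered pair of vertices, i.e. a two-element set. *)
Definition graph (T : finType) : Type := ({set T} * {set {set T}})%type.

Definition vertices (T : finType) (G : graph T) : {set T} := G.1.
Definition edges (T : finType) (G : graph T) : {set {set T}} := G.2.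

Definition simple_graph (T : finType) (G : graph T) : bool :=
  [forall e in edges G, (#|e| == 2%N) && (e \subset vertices G)].

(* Not necessarily induced, nor spanning. *)
Definition subgraph (T : finType) (H G : graph T) : bool :=
  [&& simple_graph H, vertices H \subset vertices G & edges H \subset edges G].

Definition isomorphic (T U : finType) (G : graph T) (H : graph U) : bool :=
  [exists f : {ffun T -> U},
    [&& dinjectiveb f (vertices G),
        f @: vertices G == vertices H &
        [forall x in vertices G, forall y in vertices G,
          ([set x; y] \in edges G) == ([set f x; f y] \in edges H)]]].

Definition subgraph_count (T U : finType) (G0 : graph T) (G : graph U) : nat :=
  #|[set H : graph U | subgraph H G && isomorphic H G0]|.

Definition complete_edges (n : nat) : {set {set 'I_n}} :=
  [set e : {set 'I_n} | #|e| == 2%N].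

(* The law of G(n, p): the outcomes are the graphs ([set: 'I_n], E), where E is
   any set of edges of the complete graph on 'I_n, with probability
   gnp_weight p E. *)
Definition gnp_weight (R : realType) (n : nat) (p : R) (E : {set {set 'I_n}}) :
    R :=
  \prod_(e in complete_edges n) (if e \in E then p else 1 - p).

Definition gnp_prob (R : realType) (n : nat) (p : R) (A : graph 'I_n -> bool) :
    R :=
  \sum_(E in powerset (complete_edges n) | A ([set: 'I_n], E)) gnp_weight p E.

Definition gnp_expectation (R : realType) (n : nat) (p : R)
    (X : graph 'I_n -> R) : R :=
  \sum_(E in powerset (complete_edges n)) gnp_weight p E * X ([set: 'I_n], E).

Definition gnp_variance (R : realType) (n : nat) (p : R)
    (X : graph 'I_n -> R) : R :=
  gnp_expectation p (fun G => (X G - gnp_expectation p X) ^+ 2).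

Definition gnp_standardize (R : realType) (n : nat) (p : R)
    (X : graph 'I_n -> R) (G : graph 'I_n) : R :=
  (X G - gnp_expectation p X) / Num.sqrt (gnp_variance p X).

Definition countW (R : realType) (T : finType) (G0 : graph T) (n : nat)
    (G : graph 'I_n) : R :=
  (subgraph_count G0 G)%:R.

(* G0 has an edge, so it is itself one of the H: the default value of the
   iterated minimum does not change it. *)
Definition Psi (R : realType) (T : finType) (G0 : graph T) (n : nat) (p : R) :
    R :=
  \big[Num.min / n%:R ^+ #|vertices G0| * p ^+ #|edges G0|]_(H : graph T |
      subgraph H G0 && (1 <= #|edges H|)%N)
    (n%:R ^+ #|vertices H| * p ^+ #|edges H|).

Definition Phi (R : realType) (z : R) : R :=
  fine (normal_prob (0 : R) 1 `]-oo, z]%classic).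

(* Main.v *)
From HB Require Import structures.
Require Import Defs.
From mathcomp Require Import all_boot all_order all_algebra.
From mathcomp Require Import all_classical all_reals all_analysis.
From mathcomp Require Import ring lra zify.

(** Let S_i be the edge sets of the copies i of G0 in the complete graph, X_i
    the centred indicator that S_i is present, W the sum of the X_i and
    F = W / sigma. Write q = 1 - p, v and e for the numbers of vertices and
    edges of G0, and A = n^v p^e, the order of the mean number of copies.

    The proof is Stein's method with an exchangeable pair for each copy.
    Resampling the edges of S_i changes X_i into an independent X_i' and W into
    W_i, and (stein_identity)

      E[W u(W)] = 1/2 sum_i E[(X_i - X_i') (u(W) - u(W_i))].

    For u the solution f of the Stein equation f'(w) - w f(w) = 1(w <= z) -
    Phi(z), a first-order expansion of f leaves an error that is controlled by
    the increments of the monotone functions w f(w) and 1(w > z). By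
    exchangeability such increments can be traded for values, and no absolute
    third moment appears (stein_bound): |P(F <= z) - Phi(z)| is at most
    E[G(F) |1 - T1|] + E[G(F) |T2|], where

      T1 = 1/(2 sigma^2) sum_i E'[(X_i - X_i') (W - W_i)],
      T2 = 1/sigma^2 sum_i E'[|X_i - X_i'| (W - W_i)]

    have means 1 and 0, E' averages over the resampled edges, and G(w) is
    bounded, and O(|z|^(-k)) for every k if |w| <= |z| / 2. It remains
    to bound the standard deviations of T1 and T2 and the moments of F.

    The variances. T1 and T2 are sums, over the pairs of copies that share an
    edge, of functions of the edges of the pair, and two such functions are
    correlated only if their pairs share an edge (variance_local_sum). Attaching
    a copy to a set of boundedly many edges along a subgraph H of G0 multiplies
    the expected count by n^v p^e / (n^(v_H) p^(e_H)), at most A / Psi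
    (sum_overlapping_copies); moreover nothing happens unless some edge is
    missing, which gives a factor q, kept by the functions thetaq. Hence the
    variances are O(q A (A / Psi)^3 / sigma^4). Conversely, the pairs of
    copies sharing the subgraph at which Psi is attained show that sigma^2 is at
    least of order q A^2 / Psi (copy_sum_variance_ge). So the variances are
    O(1 / (q Psi)).

    The moments. The same identity for u(w) = w^(2m+1) bounds the moments of W
    by those of a positive sum over pairs of copies (copy_sum_moment), which
    are computed one factor at a time (overlap_moment_step). This gives
    E F^(2m+2) = O((1 + 1 / (q Psi))^m). If q Psi >= c all moments are bounded,
    and every k is allowed. If q Psi < 1 and k <= 3 then E F^4 = O(1 / (q Psi)),
    so that E |F|^3 = O((q Psi)^(-1/2)), and Markov's inequality gives the bound
    (third_moment_bound). *)

Set Implicit Arguments.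
Unset Strict Implicit.
Unset Printing Implicit Defensive.

Import Order.TTheory GRing.Theory Num.Theory.
Import numFieldNormedType.Exports.

Local Open Scope ring_scope.

Lemma le_of_eq (R : numDomainType) (x y : R) : x = y -> x <= y.
Proof. by move->. Qed.

(** * The normal distribution and the Stein equation *)

(** Differentiation rules for functions written as expressions in their
    argument: stated in this form they compose as plain terms. *)
Section DerivativeRules.
Variable R : realType.
Implicit Types (f g : R -> R) (x df dg : R).

Lemma is_derive_add f g x df dg : is_derive x 1 f df -> is_derive x 1 g dg ->
  is_derive x 1 (fun y => f y + g y) (df + dg).
Proof. exact: is_deriveD. Qed.

Lemma is_derive_opp f x df : is_derive x 1 f df ->
  is_derive x 1 (fun y => - f y) (- df).
Proof. exact: is_deriveN. Qed.

Lemma is_derive_mul f g x df dg : is_derive x 1 f df -> is_derive x 1 g dg ->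
  is_derive x 1 (fun y => f y * g y) (f x * dg + g x * df).
Proof. exact: is_deriveM. Qed.

Lemma is_derive_inv f x df : f x != 0 -> is_derive x 1 f df ->
  is_derive x 1 (fun y => (f y)^-1) (- (f x) ^- 2 * df).
Proof. exact: is_deriveV. Qed.

Lemma is_derive_var x : is_derive x 1 (fun y : R => y) 1.
Proof. exact: is_derive_id. Qed.

Lemma is_derive_const (a x : R) : is_derive x 1 (fun _ : R => a) 0.
Proof. exact: is_derive_cst. Qed.

Lemma is_derive_expR_sq (c x : R) :
  is_derive x 1 (fun y => expR (c * y ^+ 2)) (2 * c * x * expR (c * x ^+ 2)).
Proof.
have h : is_derive x 1 (fun y : R => c * y ^+ 2) (c * (2 * x)).
  have : is_derive x 1 (cst c * (id ^+ 2)) (c * (2 * x)).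
    by apply: is_derive_eq; rewrite /GRing.scale /=; ring.
  exact.
have : is_derive x 1 (expR \o (fun y : R => c * y ^+ 2))
    (expR (c * x ^+ 2) * (c * (2 * x))).
  exact: is_derive1_comp.
by move=> k; apply: is_derive_eq k _; ring.
Qed.

End DerivativeRules.

Section Gaussian.
Variable R : realType.
Implicit Types (x y z w : R).

Let phi x : R := normal_pdf 0 1 x.
Let c0 : R := normal_peak 1.

Let c0_gt0 : 0 < c0.
Proof. exact/normal_peak_gt0/oner_neq0. Qed.

Let phiE x : phi x = c0 * expR (- (x ^+ 2 / 2)).
Proof.
rewrite /phi normal_pdfE ?oner_neq0// /normal_fun; congr (_ * expR _).
by rewrite subr0 expr1n mulNr.
Qed.

Let phi_gt0 x : 0 < phi x.
Proof. by rewrite phiE mulr_gt0 ?expR_gt0. Qed.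

Lemma is_derive_Phi x : is_derive x 1 (@Phi R) (phi x).
Proof.
have [||||d1 d2] := @continuous_FTC1 R phi -oo%O x (x + 1).
- by rewrite ltrDl.
- apply: (@integrableS _ _ _ _ setT) => //.
  exact: integrable_normal_pdf.
- by rewrite ltNyr.
- by apply: continuous_normal_pdf; rewrite oner_neq0.
apply: DeriveDef; first exact: d1.
by rewrite -derive1E d2.
Qed.

Lemma Phi_ge0 x : 0 <= Phi x.
Proof. exact/fine_ge0/measure_ge0. Qed.

Let idTR : measurableTypeR R -> R := idfun.
#[local] HB.instance Definition _ :=
  @isMeasurableFun.Build _ _ _ _ idTR (@measurable_id _ _ setT).

Let PhiE x : (Phi x)%:E = cdf (idTR : {RV (@normal_prob R 0 1) >-> R}) x.
Proof.
rewrite /cdf /distribution /pushforward preimage_id /Phi fineK//.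
by apply: fin_num_measure.
Qed.

Let cdf_Phi : cdf (idTR : {RV (@normal_prob R 0 1) >-> R}) = EFin \o @Phi R.
Proof. by apply/funext => x; rewrite -PhiE. Qed.

Lemma Phi_le1 x : Phi x <= 1.
Proof. by rewrite -lee_fin PhiE cdf_le1. Qed.

Lemma Phi_cvgNy0 (e : R) : 0 < e -> exists N : R, forall x, x <= N -> Phi x < e.
Proof.
move=> e0; have := cvg_cdfNy0 (idTR : {RV (@normal_prob R 0 1) >-> R}).
rewrite cdf_Phi.
move/fine_cvgP => -[_ /cvgr0Pnorm_lt /(_ e e0)] [N [_ hN]].
exists (N - 1) => x xN.
have /hN/= : x < N by lra.
by rewrite ger0_norm// Phi_ge0.
Qed.

Lemma Phi_cvgy1 (e : R) : 0 < e -> exists N : R, forall x, N <= x -> 1 - e < Phi x.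
Proof.
move=> e0; have := cvg_cdfy1 (idTR : {RV (@normal_prob R 0 1) >-> R}).
rewrite cdf_Phi.
move/fine_cvgP => -[_ /cvgrPdist_lt /(_ e e0)] [N [_ hN]].
exists (N + 1) => x xN.
have /hN/= : N < x by lra.
by rewrite ger0_norm ?subr_ge0 ?Phi_le1//; lra.
Qed.

Lemma is_derive_ndecr (f df : R -> R) x y : x <= y ->
  (forall t, x <= t <= y -> is_derive t 1 f (df t) /\ 0 <= df t) -> f x <= f y.
Proof.
rewrite le_eqVlt => /predU1P[->//|xy] h.
have hd t : t \in `]x, y[ -> is_derive t 1 f (df t).
  by rewrite in_itv/= => /andP[/ltW xt /ltW ty]; apply: (h t _).1; rewrite xt.
have cf : {within `[x, y], continuous f}%classic.
  apply: derivable_within_continuous => t; rewrite in_itv/= => t_.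
  by have [] := (h t t_).1.
have [c] := MVT xy hd cf; rewrite in_itv/= => /andP[/ltW xc /ltW cy] e.
rewrite -subr_ge0 e mulr_ge0 ?subr_ge0 ?(ltW xy)//.
by apply: (h c _).2; rewrite xc.
Qed.

(** The derivative of Phi(x) + Phi(-x) vanishes, and this sum tends to 1. *)
Lemma Phi_opp x : Phi (- x) = 1 - Phi x.
Proof.
pose s := (@Phi R \+ (@Phi R \o -%R)).
have ds (t : R) : is_derive t 1 s 0.
  have h1 := is_derive_Phi t.
  have h2 := is_derive_Phi (- t).
  have h3 : is_derive t 1 (@Phi R \o -%R) (phi (- t) * -1).
    by apply: is_derive1_comp.
  have h4 : is_derive t 1 s (phi t + phi (- t) * -1) by apply: is_deriveD.
  apply: is_derive_eq h4 _.
  by rewrite !phiE sqrrN; lra.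
have s_const a b : a <= b -> s a = s b.
  move=> ab; apply/eqP; rewrite eq_le; apply/andP; split.
    by apply: (@is_derive_ndecr s (cst 0)) => // t _; split.
  rewrite -lerN2; apply: (@is_derive_ndecr (- s) (cst 0)) => // t _; split => //.
  by rewrite -[cst 0 t]oppr0; apply: is_deriveN.
suff : s x = 1 by rewrite /s/=; lra.
apply/eqP; rewrite -subr_eq0 -normr_eq0; apply/negPn/negP => nz.
have e0 : 0 < `|s x - 1| by rewrite lt_neqAle eq_sym nz normr_ge0.
set e := `|s x - 1| in e0 *.
have [N1 h1] := Phi_cvgNy0 e0.
have [N2 h2] := Phi_cvgy1 e0.
pose b := Num.max x (Num.max (- N1) N2).
have xb : x <= b by rewrite le_max lexx.
have : `|s x - 1| < e.
  rewrite (s_const _ _ xb) /s/=.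
  have /h1 : - b <= N1 by rewrite lerNl !le_max lexx orbT.
  have /h2 : N2 <= b by rewrite !le_max lexx !orbT.
  have := Phi_le1 b; have := Phi_ge0 (- b).
  by rewrite ltr_norml => *; apply/andP; split; lra.
by rewrite /e ltxx.
Qed.

(** The Mills ratio of the lower tail, the solution of f' = w f + 1 that stays
    bounded at -oo. *)
Definition mills w : R := Phi w / phi w.

Lemma is_derive_phi x : is_derive x 1 phi (- x * phi x).
Proof.
have -> : phi = (fun x => c0 * expR (- 2^-1 * x ^+ 2)).
  by apply/funext => t; rewrite phiE; congr (_ * expR _); rewrite mulNr mulrC.
apply: is_derive_eq (is_derive_mul (is_derive_const c0 x)
  (is_derive_expR_sq (- 2^-1) x)) _.
by field.
Qed.

Lemma is_derive_mills w : is_derive w 1 mills (w * mills w + 1).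
Proof.
have p0 : phi w != 0 by rewrite gt_eqF.
apply: is_derive_eq (is_derive_mul (is_derive_Phi w)
  (@is_derive_inv _ phi w _ p0 (is_derive_phi w))) _.
by rewrite /mills; field.
Qed.

Lemma mills_ge0 w : 0 <= mills w.
Proof. by rewrite divr_ge0 ?Phi_ge0 ?ltW. Qed.

(** Used with functions f that increase from a nonnegative limit at -oo. *)
Lemma ge0_of_tail (f : R -> R) y :
    (forall e, 0 < e -> exists2 x, x <= y & - e <= f x) ->
    (forall x, x <= y -> f x <= f y) -> 0 <= f y.
Proof.
move=> tail mono; rewrite leNgt; apply/negP => fy.
have [|x xy] := tail (- f y / 2); first by lra.
by have := mono _ xy; lra.
Qed.

(** The difference Phi(x) + x phi(x) / (1 + x^2) tends to 0 at -oo, and its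
    derivative 2 phi(x) / (1 + x^2)^2 is positive. *)
Lemma mills_ge w : - w / (1 + w ^+ 2) <= mills w.
Proof.
pose k x := Phi x + x / (1 + x * x) * phi x.
have p1 (x : R) : 0 < 1 + x ^+ 2 by have := sqr_ge0 x; lra.
suff : 0 <= k w.
  rewrite /k -expr2 /mills ler_pdivlMr// mulNr mulNr; lra.
apply: ge0_of_tail => [e e0|x xw].
  (* as phi <= c0, the product |x|^-1 phi(x) is at most e once |x| >= c0 / e *)
  pose x := Num.min w (- (c0 / e) - 1).
  have ce : 0 < c0 / e by rewrite divr_gt0.
  have xce : x <= - (c0 / e) - 1 by rewrite ge_min lexx orbT.
  have x0 : x < 0 by lra.
  exists x; first by rewrite ge_min lexx.
  have h1 := Phi_ge0 x.
  have h2 : phi x <= c0.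
    rewrite phiE ger_pMr// expR_le1.
    by have := sqr_ge0 x; lra.
  have h3 : - x^-1 <= e / c0.
    rewrite -[e / c0]invrK invfM invrK mulrC -invrN lef_pV2 ?posrE; lra.
  have h4 : - (x / (1 + x ^+ 2)) <= - x^-1.
    rewrite -mulNr -invrN ler_pdivrMr// -[leRHS]mulrC ler_pdivlMr; [|lra].
    by rewrite mulrNN expr2; lra.
  rewrite /k -expr2; have : - (x / (1 + x ^+ 2)) * phi x <= e / c0 * c0.
    by apply: ler_pM => //; [rewrite -mulNr divr_ge0 ?ltW//; lra|rewrite ltW|lra].
  rewrite divfK ?gt_eqF//; lra.
apply: (@is_derive_ndecr k (fun x => 2 * phi x / (1 + x ^+ 2) ^+ 2)) => // t _; split.
  have p0 : 1 + t * t != 0 by rewrite -expr2 gt_eqF.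
  have v := is_derive_var t.
  have dV := @is_derive_inv _ (fun y => 1 + y * y) t _ p0
    (is_derive_add (is_derive_const 1 t) (is_derive_mul v v)).
  apply: is_derive_eq (is_derive_add (is_derive_Phi t)
    (is_derive_mul (is_derive_mul v dV) (is_derive_phi t))) _.
  by field; rewrite gt_eqF.
by rewrite divr_ge0 ?exprn_ge0 ?(ltW (p1 _))// mulr_ge0// ltW.
Qed.

(** The difference -phi(x) / x - Phi(x) tends to 0 at -oo, and its derivative
    phi(x) / x^2 is positive. *)
Lemma mills_le w : w < 0 -> mills w <= - w^-1.
Proof.
move=> w0; pose k x := - (phi x / x) - Phi x.
suff : 0 <= k w.
  rewrite /k /mills ler_pdivrMr//; lra.
apply: ge0_of_tail => [e e0|x xw].
  have [N hN] := Phi_cvgNy0 e0.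
  exists (Num.min w N); first by rewrite ge_min lexx.
  have m0 : Num.min w N < 0 by rewrite gt_min w0.
  have := hN (Num.min w N); rewrite ge_min lexx orbT => /(_ isT).
  have : 0 <= - (phi (Num.min w N) / Num.min w N).
    by rewrite -mulrN mulr_ge0 ?(ltW (phi_gt0 _))// oppr_ge0 invr_le0 ltW.
  rewrite /k; lra.
apply: (@is_derive_ndecr k (fun x => phi x / x ^+ 2)) => // t /andP[_ tw]; split.
  have tn0 : t != 0 by rewrite lt_eqF// (le_lt_trans tw).
  apply: is_derive_eq (is_derive_add (is_derive_opp (is_derive_mul
    (is_derive_phi t) (@is_derive_inv _ id t _ tn0 (is_derive_var t))))
    (is_derive_opp (is_derive_Phi t))) _.
  by field.
by rewrite divr_ge0 ?sqr_ge0 ?(ltW (phi_gt0 _)).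
Qed.

(** The derivative is (1 + x^2) mills x + x, whence the need for the sharp
    lower bound mills_ge. *)
Lemma wmills_ndecr x y : x <= y -> x * mills x <= y * mills y.
Proof.
move=> xy; apply: (@is_derive_ndecr (fun x => x * mills x)
   (fun x => (1 + x ^+ 2) * mills x + x)) => // t _; split.
  apply: is_derive_eq (is_derive_mul (is_derive_var t) (is_derive_mills t)) _.
  by ring.
have p1 : 0 < 1 + t ^+ 2 by have := sqr_ge0 t; lra.
by have := mills_ge t; rewrite ler_pdivrMr//; lra.
Qed.

Lemma wmills_geN1 x : -1 <= x * mills x.
Proof.
have [x0|x0] := leP 0 x.
  by apply: le_trans (mulr_ge0 x0 (mills_ge0 x)); lra.
have := mills_le x0; rewrite -(ler_nM2l x0) mulrN divff ?lt_eqF//.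
Qed.

Lemma mills_ndecr x y : x <= y -> mills x <= mills y.
Proof.
move=> xy; apply: (is_derive_ndecr xy (df := fun x => x * mills x + 1)) => t _.
by split; [exact: is_derive_mills|have := wmills_geN1 t; lra].
Qed.

Lemma mills_increment x y : x <= y ->
  (x * mills x + 1) * (y - x) <= mills y - mills x <= (y * mills y + 1) * (y - x).
Proof.
move=> xy.
have cf : {within `[x, y], continuous mills}%classic.
  apply: derivable_within_continuous => t _.
  by have [] := is_derive_mills t.
have hd t : t \in `]x, y[ -> is_derive t 1 mills (t * mills t + 1).
  by move=> _; exact: is_derive_mills.
have [c] := MVT_segment xy hd cf.
rewrite in_itv/= => /andP[xc cy] ->.
have := wmills_ndecr xc; have := wmills_ndecr cy => h1 h2.
by rewrite !ler_wpM2r ?lerD2r ?subr_ge0.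
Qed.

Lemma mills_opp z : mills z * (1 - Phi z) = mills (- z) * Phi z.
Proof.
rewrite /mills -Phi_opp !phiE sqrrN; ring.
Qed.

Lemma Phi_le_expR z : z <= 0 -> Phi z <= expR (- (z ^+ 2 / 2)).
Proof.
move=> z0.
have -> : Phi z = mills z * phi z by rewrite divfK// gt_eqF.
have h : mills z <= c0^-1.
  apply: le_trans (mills_ndecr z0) _.
  rewrite /mills phiE expr0n/= mul0r oppr0 expR0 mulr1 ler_pdivrMr// mulVf ?gt_eqF//.
  exact: Phi_le1.
apply: le_trans (ler_wpM2r _ h) _; first exact/ltW.
by rewrite phiE mulrA mulVf ?gt_eqF// mul1r.
Qed.

Lemma mills_le_expR w : mills w <= c0^-1 * expR (w ^+ 2 / 2).
Proof.
rewrite /mills phiE expRN invfM (invrK (expR _)) ler_piMl ?Phi_le1//.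
by rewrite mulr_ge0 ?expR_ge0// invr_ge0 (ltW c0_gt0).
Qed.

(** Turns the Gaussian decay of the Stein solution into polynomial decay of
    arbitrary order. *)
Lemma poly_expR_bounded (k : nat) : exists2 C : R, 0 < C &
  forall x, 0 <= x -> (1 + x) ^+ k * expR (- (x ^+ 2 / 4)) <= C.
Proof.
pose C : R := 2 ^+ k * (4 ^+ k.+1 * (k.+1)`!%:R).
have f1 : 1 <= (k.+1)`!%:R :> R by rewrite ler1n fact_gt0.
have f4 : 1 <= 4 ^+ k.+1 :> R by rewrite exprn_ege1// ler1n.
have C0 : 0 < C by rewrite !mulr_gt0 ?exprn_gt0// ltr0n ?fact_gt0.
exists C => // x x0.
rewrite expRN ler_pdivrMr ?expR_gt0//.
set y := x ^+ 2 / 4.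
have y0 : 0 <= y by rewrite divr_ge0 ?sqr_ge0.
have h := expR_ge1Dxn k y0.
apply: le_trans (ler_wpM2l (ltW C0) h).
have h1 : (1 + x) ^+ k <= 2 ^+ k * (1 + x ^+ (2 * k.+1)).
  have [x1|x1] := leP x 1.
    apply: (@le_trans _ _ (2 ^+ k * 1)); last first.
      by rewrite ler_wpM2l ?exprn_ge0// lerDl exprn_ge0.
    by rewrite mulr1 lerXn2r ?nnegrE//; lra.
  apply: (@le_trans _ _ ((2 * x) ^+ k)).
    by rewrite lerXn2r ?nnegrE//; lra.
  rewrite exprMn ler_wpM2l ?exprn_ge0//.
  apply: (@le_trans _ _ (x ^+ (2 * k.+1))); last by rewrite lerDr.
  by rewrite ler_weXn2l ?(ltW x1)//; lia.
apply: le_trans h1 _; rewrite /C -mulrA ler_wpM2l ?exprn_ge0//.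
rewrite exprM.
have -> : x ^+ 2 = 4 * y by rewrite /y; field.
rewrite exprMn mulrDr mulr1; apply: lerD.
  by rewrite -[leLHS]mulr1 ler_pM.
by rewrite -mulrA ler_wpM2l ?exprn_ge0// mulrCA mulfV ?mulr1// gt_eqF// ltr0n fact_gt0.
Qed.

(** The bounded solution f of f'(w) - w f(w) = 1(w <= z) - Phi(z); it is
    continuous but not differentiable at z. *)
Definition stein_solution z w : R :=
  if w <= z then mills w * (1 - Phi z) else mills (- w) * Phi z.

Lemma stein_mul z w : w * stein_solution z w =
  if w <= z then w * mills w * (1 - Phi z) else - (- w * mills (- w) * Phi z).
Proof. by rewrite /stein_solution; case: ifP => _; ring. Qed.

Lemma stein_geE z w : z <= w -> stein_solution z w = mills (- w) * Phi z.
Proof.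
rewrite le_eqVlt => /predU1P[->|zw]; last by rewrite /stein_solution leNgt zw.
by rewrite /stein_solution lexx mills_opp.
Qed.

Let PhiC_ge0 z : 0 <= 1 - Phi z. Proof. by rewrite subr_ge0 Phi_le1. Qed.

Lemma stein_mul_ndecr z w w' : w <= w' -> w * stein_solution z w <= w' * stein_solution z w'.
Proof.
have low x y : x <= y -> y <= z -> x * stein_solution z x <= y * stein_solution z y.
  move=> xy yz; rewrite !stein_mul yz (le_trans xy yz).
  by rewrite ler_wpM2r ?PhiC_ge0// wmills_ndecr.
have high x y : z <= x -> x <= y -> x * stein_solution z x <= y * stein_solution z y.
  move=> zx xy; rewrite !stein_geE ?(le_trans zx xy)//.
  rewrite (mulrA x (mills _)) (mulrA y (mills _)).
  rewrite ler_wpM2r ?Phi_ge0//.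
  by have := @wmills_ndecr (- y) (- x); rewrite lerN2 => /(_ xy); lra.
move=> ww'; have [wz|/ltW wz] := leP w' z; first exact: low.
have [zw|/ltW zw] := leP z w; first exact: high.
exact: le_trans (low _ _ zw (lexx z)) (high _ _ (lexx z) wz).
Qed.

Lemma stein_mul_le1 z w : `|w * stein_solution z w| <= 1.
Proof.
rewrite ler_norml; apply/andP; split.
  have [wz|/ltW zw] := leP w z.
    rewrite stein_mul wz.
    have := wmills_geN1 w; have := PhiC_ge0 z; have := Phi_ge0 z; nra.
  apply: le_trans (stein_mul_ndecr z zw).
  rewrite stein_mul lexx.
  have := wmills_geN1 z; have := PhiC_ge0 z; have := Phi_ge0 z; nra.
have h (y : R) : z <= y -> y * stein_solution z y <= 1.
  move=> zy; rewrite stein_geE// (mulrA y (mills _)).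
  have := wmills_geN1 (- y); have := PhiC_ge0 z; have := Phi_ge0 z; nra.
have [/h//|/ltW wz] := leP z w.
exact: le_trans (stein_mul_ndecr z wz) (h z (lexx z)).
Qed.

(** The mean value theorem on both sides of the kink z, with the derivative
    given by the Stein equation and w f(w) nondecreasing. *)
Lemma stein_increment z w w' : w <= w' ->
  (w * stein_solution z w + (w' <= z)%R%:R - Phi z) * (w' - w) <= stein_solution z w' - stein_solution z w
  <= (w' * stein_solution z w' + (w <= z)%R%:R - Phi z) * (w' - w).
Proof.
have low x y : x <= y -> y <= z ->
    (x * stein_solution z x + 1 - Phi z) * (y - x) <= stein_solution z y - stein_solution z x
    <= (y * stein_solution z y + 1 - Phi z) * (y - x).
  move=> xy yz; rewrite /stein_solution yz (le_trans xy yz) -mulrBl.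
  have := mills_increment xy => /andP[h1 h2]; have c := PhiC_ge0 z.
  have k1 := ler_wpM2r c h1; have k2 := ler_wpM2r c h2.
  by apply/andP; split; lra.
have high x y : z <= x -> x <= y ->
    (x * stein_solution z x - Phi z) * (y - x) <= stein_solution z y - stein_solution z x
    <= (y * stein_solution z y - Phi z) * (y - x).
  move=> zx xy; rewrite !stein_geE ?(le_trans zx xy)// -mulrBl.
  have xyN : - y <= - x by rewrite lerN2.
  have := mills_increment xyN => /andP[h1 h2]; have c := Phi_ge0 z.
  have k1 := ler_wpM2r c h1; have k2 := ler_wpM2r c h2.
  by apply/andP; split; lra.
move=> ww'; have [wz|wz] := leP w' z.
  by rewrite (le_trans ww' wz); exact: low.
have [zw|zw] := leP w z; last by rewrite !addr0; apply: high => //; exact: ltW.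
have /andP[l1 l2] := low _ _ zw (lexx z).
have /andP[h1 h2] := high _ _ (lexx z) (ltW wz).
have m1 := stein_mul_ndecr z zw; have m2 := stein_mul_ndecr z (ltW wz).
rewrite addr0 (_ : true%:R = 1)//; apply/andP; split.
  have k1 : (w * stein_solution z w - Phi z) * (z - w) <=
            (w * stein_solution z w + 1 - Phi z) * (z - w).
    by apply: ler_wpM2r; lra.
  have k2 : (w * stein_solution z w - Phi z) * (w' - z) <=
            (z * stein_solution z z - Phi z) * (w' - z).
    by apply: ler_wpM2r; lra.
  lra.
have k1 : (z * stein_solution z z + 1 - Phi z) * (z - w) <=
          (w' * stein_solution z w' + 1 - Phi z) * (z - w).
  by apply: ler_wpM2r; lra.
have k2 : (w' * stein_solution z w' - Phi z) * (w' - z) <=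
          (w' * stein_solution z w' + 1 - Phi z) * (w' - z).
  by apply: ler_wpM2r; lra.
lra.
Qed.

(** If |w| <= |z| / 2 then w and 0 lie on the same side of z, so that the left
    member is a Gaussian tail. *)
Lemma Phi_tail (k : nat) : exists2 C : R, 0 < C & forall z w,
  `|w| <= `|z| / 2 -> `|(w <= z)%R%:R - Phi z| <= C / (1 + `|z|) ^+ k.
Proof.
have [C C0 hC] := poly_expR_bounded k.
exists (C + 1) => [|z w wz]; first lra.
have z1 : 0 < (1 + `|z|) ^+ k by rewrite exprn_gt0// ltr_pwDl.
rewrite ler_pdivlMr//.
have [->|zn0] := eqVneq z 0.
  rewrite normr0 addr0 expr1n mulr1.
  have := Phi_ge0 0; have := Phi_le1 0; rewrite ler_norml.
  by case: (w <= 0) => /= *; apply/andP; split; lra.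
have key : `|(w <= z)%R%:R - Phi z| <= expR (- (z ^+ 2 / 4)).
  have e1 : expR (- (z ^+ 2 / 2)) <= expR (- (z ^+ 2 / 4)).
    by rewrite ler_expR; have := sqr_ge0 z; lra.
  apply: le_trans e1; move: wz zn0; have [z0|z0] := leP 0 z => wz zn0.
    have -> : w <= z.
      by have := ler_norm w; move: wz; rewrite (ger0_norm z0); lra.
    rewrite ger0_norm ?PhiC_ge0// -Phi_opp -sqrrN Phi_le_expR//; lra.
  have -> : (w <= z) = false.
    apply/negbTE; rewrite -ltNge; have := ler_norm (- w); move: wz.
    by rewrite normrN (ltr0_norm z0); lra.
  rewrite sub0r normrN ger0_norm ?Phi_ge0// Phi_le_expR//; lra.
apply: le_trans (ler_wpM2r (ltW z1) key) _.
have := hC `|z| (normr_ge0 z); rewrite real_normK ?num_real// => h.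
by rewrite mulrC; lra.
Qed.

(** For |w| <= |z| / 2 the factor exp(w^2 / 2) is at most exp(z^2 / 8), which
    the tail exp(-z^2 / 2) outweighs. *)
Lemma stein_mul_tail (k : nat) : exists2 C : R, 0 < C & forall z w,
  `|w| <= `|z| / 2 -> `|w * stein_solution z w| <= C / (1 + `|z|) ^+ k.
Proof.
have [C C0 hC] := poly_expR_bounded k.+1.
exists (c0^-1 * C) => [|z w wz]; first by apply: mulr_gt0 => //; rewrite invr_gt0; exact: c0_gt0.
have z1 : 0 < (1 + `|z|) ^+ k by rewrite exprn_gt0// ltr_pwDl.
rewrite ler_pdivlMr//.
have key : `|stein_solution z w| <= c0^-1 * expR (w ^+ 2 / 2) * expR (- (z ^+ 2 / 2)).
  have [z0|z0] := leP 0 z.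
    have wz' : w <= z by have := ler_norm w; move: wz; rewrite (ger0_norm z0); lra.
    rewrite /stein_solution wz' normrM !ger0_norm ?PhiC_ge0 ?mills_ge0//.
    apply: ler_pM; rewrite ?PhiC_ge0 ?mills_ge0 ?mills_le_expR//.
    rewrite -Phi_opp -sqrrN Phi_le_expR//; lra.
  have wz' : z <= w.
    by have := ler_norm (- w); move: wz; rewrite normrN (ltr0_norm z0); lra.
  rewrite stein_geE// normrM !ger0_norm ?Phi_ge0 ?mills_ge0//.
  apply: ler_pM; rewrite ?Phi_ge0 ?mills_ge0 ?mills_le_expR//.
    by rewrite -(sqrrN w) mills_le_expR.
  by rewrite Phi_le_expR// ltW.
have w2 : w ^+ 2 <= z ^+ 2 / 4.
  rewrite -[w ^+ 2]real_normK ?num_real// -[z ^+ 2]real_normK ?num_real//.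
  have -> : `|z| ^+ 2 / 4 = (`|z| / 2) ^+ 2 by field.
  by rewrite lerXn2r// nnegrE ?normr_ge0//; have := normr_ge0 z; lra.
have key2 : `|stein_solution z w| <= c0^-1 * expR (- (`|z| ^+ 2 / 4)).
  apply: le_trans key _; rewrite -mulrA -expRD ler_wpM2l// ?(invr_ge0 c0) ?(ltW c0_gt0)//.
  by rewrite ler_expR real_normK ?num_real//; have := sqr_ge0 z; lra.
rewrite normrM.
have wz1 : `|w| <= 1 + `|z| by have := normr_ge0 z; lra.
apply: (@le_trans _ _ ((1 + `|z|) * (c0^-1 * expR (- (`|z| ^+ 2 / 4))) * (1 + `|z|) ^+ k)).
  by apply: ler_wpM2r; [exact: ltW|exact: ler_pM].
have := hC `|z| (normr_ge0 z) => h.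
have -> : (1 + `|z|) * (c0^-1 * expR (- (`|z| ^+ 2 / 4))) * (1 + `|z|) ^+ k =
  c0^-1 * ((1 + `|z|) ^+ k.+1 * expR (- (`|z| ^+ 2 / 4))) by rewrite (exprS (1 + `|z|)); ring.
by rewrite ler_wpM2l// (invr_ge0 c0) (ltW c0_gt0).
Qed.

(** Bounds both the derivative of the Stein solution at w and its monotone
    part, up to a constant shift. *)
Definition stein_size z w : R :=
  `|w * stein_solution z w| + `|(w <= z)%R%:R - Phi z|.

Lemma stein_size_ge0 z w : 0 <= stein_size z w.
Proof. by rewrite addr_ge0. Qed.

Lemma Phi_dist_le1 z w : `|(w <= z)%R%:R - Phi z| <= 1.
Proof.
have := Phi_ge0 z; have := Phi_le1 z; rewrite ler_norml.
by case: (w <= z) => /= *; apply/andP; split; lra.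
Qed.

Lemma stein_size_le2 z w : stein_size z w <= 2.
Proof. by have := stein_mul_le1 z w; have := Phi_dist_le1 z w; rewrite /stein_size; lra. Qed.

Lemma stein_size_tail (k : nat) : exists2 C : R, 0 < C & forall z w,
  `|w| <= `|z| / 2 -> stein_size z w <= C / (1 + `|z|) ^+ k.
Proof.
have [C1 C1_gt0 h1] := stein_mul_tail k; have [C2 C2_gt0 h2] := Phi_tail k.
exists (C1 + C2) => [|z w wz]; first exact: addr_gt0.
by rewrite mulrDl; apply: lerD; [exact: h1|exact: h2].
Qed.

End Gaussian.

(** * Independent edges *)

Section ProductSpace.
Variables (R : realType) (D : finType) (P : D -> R).
Hypothesis P01 : forall d, 0 <= P d <= 1.
Implicit Types (E S A B : {set D}) (f g : {set D} -> R).

Definition weight E : R := \prod_d (if d \in E then P d else 1 - P d).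

Definition Ex f : R := \sum_(E : {set D}) weight E * f E.

Definition Ex2 (f : {set D} -> {set D} -> R) : R := Ex (fun E => Ex (f E)).

Lemma weight_ge0 E : 0 <= weight E.
Proof.
by apply: prodr_ge0 => d _; have /andP[h1 h2] := P01 d; case: ifP => _; lra.
Qed.

Lemma Ex_prod (h : D -> bool -> R) :
  Ex (fun E => \prod_d h d (d \in E)) =
  \prod_d (P d * h d true + (1 - P d) * h d false).
Proof.
rewrite bigA_distr; apply: eq_bigr => E _.
by rewrite /weight -big_split /=; apply: eq_bigr => d _; case: ifP.
Qed.

Lemma Ex_prod_in S (h : D -> bool -> R) :
  Ex (fun E => \prod_(d in S) h d (d \in E)) =
  \prod_(d in S) (P d * h d true + (1 - P d) * h d false).
Proof.
rewrite [RHS]big_mkcond /=.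
have := Ex_prod (fun d b => if d \in S then h d b else 1) => e.
transitivity (Ex (fun E => \prod_d (if d \in S then h d (d \in E) else 1))).
  by apply: eq_bigr => E _; rewrite big_mkcond.
rewrite e; apply: eq_bigr => d _; case: ifP => // _; ring.
Qed.

Lemma eq_Ex f g : f =1 g -> Ex f = Ex g.
Proof. by move=> fg; apply: eq_bigr => E _; rewrite fg. Qed.

Lemma ExD f g : Ex (fun E => f E + g E) = Ex f + Ex g.
Proof. by rewrite -big_split /=; apply: eq_bigr => E _; rewrite mulrDr. Qed.

Lemma ExZ a f : Ex (fun E => a * f E) = a * Ex f.
Proof. by rewrite mulr_sumr; apply: eq_bigr => E _; rewrite mulrCA. Qed.

Lemma ExZr a f : Ex (fun E => f E * a) = Ex f * a.
Proof. by rewrite mulr_suml; apply: eq_bigr => E _; rewrite mulrA. Qed.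

Lemma ExN f : Ex (fun E => - f E) = - Ex f.
Proof. by rewrite -mulN1r -ExZ; apply: eq_Ex => E; rewrite mulN1r. Qed.

Lemma ExB f g : Ex (fun E => f E - g E) = Ex f - Ex g.
Proof. by rewrite ExD ExN. Qed.

Lemma Ex_sum (I : finType) (r : pred I) (F : I -> {set D} -> R) :
  Ex (fun E => \sum_(i | r i) F i E) = \sum_(i | r i) Ex (F i).
Proof.
by rewrite exchange_big; apply: eq_bigr => E _; rewrite mulr_sumr.
Qed.

Lemma Ex_cst (a : R) : Ex (fun=> a) = a.
Proof.
have := Ex_prod (fun _ _ => 1); under eq_Ex => E do rewrite big1 //.
rewrite big1 => [h|d _]; last by ring.
rewrite -[in RHS](mulr1 a) -h -ExZ; apply: eq_Ex => E; by rewrite mulr1.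
Qed.

Lemma le_Ex f g : (forall E, f E <= g E) -> Ex f <= Ex g.
Proof. by move=> h; apply: ler_sum => E _; rewrite ler_wpM2l ?weight_ge0. Qed.

Lemma Ex_ge0 f : (forall E, 0 <= f E) -> 0 <= Ex f.
Proof. by move=> h; apply: sumr_ge0 => E _; rewrite mulr_ge0 ?weight_ge0. Qed.

Lemma ler_norm_Ex f : `|Ex f| <= Ex (fun E => `|f E|).
Proof.
apply: le_trans (ler_norm_sum _ _ _) _.
by apply: ler_sum => E _; rewrite normrM (ger0_norm (weight_ge0 E)).
Qed.

(** E after its edges in S have been resampled from E'. *)
Definition mix S E E' : {set D} := (E :\: S) :|: (E' :&: S).

Lemma in_mix S E E' d :
  (d \in mix S E E') = if d \in S then d \in E' else d \in E.
Proof. by rewrite !inE; case: (d \in S); rewrite ?andbF ?andbT ?orbF. Qed.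

Lemma mixK S E E' : mix S (mix S E E') (mix S E' E) = E.
Proof. by apply/setP => d; rewrite !in_mix; case: (d \in S). Qed.

Lemma weight_mix S E E' :
  weight (mix S E E') * weight (mix S E' E) = weight E * weight E'.
Proof.
rewrite -!big_split /=; apply: eq_bigr => d _; rewrite !in_mix.
by case: (d \in S) => //; rewrite mulrC.
Qed.

Lemma Ex2E F : Ex2 F = \sum_(EE : {set D} * {set D})
  weight EE.1 * weight EE.2 * F EE.1 EE.2.
Proof.
rewrite -(pair_bigA _ (fun E E' => weight E * weight E' * F E E')) /=.
apply: eq_bigr => E _; rewrite mulr_sumr; apply: eq_bigr => E' _.
by rewrite mulrA.
Qed.

(** Exchanging the states of the edges of S between two independent copies of
    the random edge set is an involution that preserves their joint law. *)
Lemma Ex2_swap S F :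
  Ex2 (fun E E' => F (mix S E E') (mix S E' E)) = Ex2 F.
Proof.
rewrite !Ex2E.
rewrite [RHS](reindex_inj (h := fun EE => (mix S EE.1 EE.2, mix S EE.2 EE.1))).
  by apply: eq_bigr => -[E E'] _ /=; rewrite weight_mix.
apply: (can_inj (g := fun EE => (mix S EE.1 EE.2, mix S EE.2 EE.1))).
by move=> [E E'] /=; rewrite !mixK.
Qed.

(** (E, mix S E E') is an exchangeable pair. *)
Lemma Ex2_exchange S F :
  Ex2 (fun E E' => F E (mix S E E')) = Ex2 (fun E E' => F (mix S E E') E).
Proof.
rewrite -(Ex2_swap S (fun E E' => F E (mix S E E'))).
by apply: eq_Ex => E; apply: eq_Ex => E'; rewrite mixK.
Qed.

Lemma Ex2_mix S f : Ex2 (fun E E' => f (mix S E E')) = Ex f.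
Proof.
rewrite (Ex2_swap S (fun E _ => f E)).
by apply: eq_Ex => E; rewrite Ex_cst.
Qed.

Definition depends_on S f :=
  forall E E', {in S, forall d, (d \in E) = (d \in E')} -> f E = f E'.

(** Resampling the edges of B replaces g by an independent copy and leaves f
    unchanged. *)
Lemma Ex_indep A B f g : [disjoint A & B] ->
  depends_on A f -> depends_on B g ->
  Ex (fun E => f E * g E) = Ex f * Ex g.
Proof.
move=> AB fA gB.
rewrite -(Ex2_mix B (fun E => f E * g E)) -ExZr; apply: eq_Ex => E.
rewrite -ExZ; apply: eq_Ex => E'; congr (_ * _).
  apply: fA => d dA; rewrite in_mix; case: ifP => // dB.
  by have /pred0P/(_ d)/= := AB; rewrite dA dB.
by apply: gB => d dB; rewrite in_mix dB.
Qed.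

Definition present S E : R := (S \subset E)%:R.

Lemma presentE S E : present S E = \prod_(d in S) (d \in E)%:R.
Proof.
rewrite /present; case: fintype.subsetP => [h|h].
  by rewrite big1 // => d /h ->.
have [d dS dE] : exists2 d, d \in S & d \notin E.
  apply/exists_inP; apply: contra_notT h.
  by move=> /exists_inPn h d /h; rewrite negbK.
by rewrite (bigD1 d) //= (negbTE dE) mul0r.
Qed.

Lemma depends_on_present S : depends_on S (present S).
Proof.
move=> E E' h; rewrite !presentE; apply: eq_bigr => d dS.
by rewrite (h d dS).
Qed.

Variable p : R.
Hypothesis p01 : 0 <= p <= 1.
Let p_ge0 : 0 <= p. Proof. by case/andP: p01. Qed.
Let q_ge0 : 0 <= 1 - p. Proof. by rewrite subr_ge0; case/andP: p01. Qed.

Lemma Ex_present S : {in S, forall d, P d = p} -> Ex (present S) = p ^+ #|S|.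
Proof.
move=> PS.
transitivity (Ex (fun E => \prod_(d in S) (d \in E)%:R)).
  by apply: eq_Ex => E; rewrite presentE.
rewrite (Ex_prod_in S (fun _ b => b%:R)) -prodr_const.
by apply: eq_bigr => d /PS ->; rewrite mulr1 mulr0 addr0.
Qed.

(** Expanding the product gives the sum, over the subsets X of S, of
    p^|S \ X| 1(X present): it dominates every average of indicators of
    presence in which some edges of S have been resampled. *)
Definition theta S E : R := \prod_(d in S) (p + (d \in E)%:R).

(** Also requires that some edge of S be missing, before or after resampling;
    this gives the factor q = 1 - p, without which the bounds would fail
    for p close to 1. *)
Definition thetaq S E : R :=
  theta S E * \sum_(d in S) ((1 - p) + (d \notin E)%:R).

Lemma theta_ge0 S E : 0 <= theta S E.
Proof. by apply: prodr_ge0 => d _; rewrite addr_ge0. Qed.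

Let miss_ge0 S E : 0 <= \sum_(d in S) ((1 - p) + (d \notin E)%:R).
Proof. by apply: sumr_ge0 => d _; rewrite addr_ge0. Qed.

Lemma thetaq_ge0 S E : 0 <= thetaq S E.
Proof. by rewrite mulr_ge0 ?theta_ge0. Qed.

Lemma depends_on_theta S : depends_on S (theta S).
Proof. by move=> E E' h; apply: eq_bigr => d /h ->. Qed.

Lemma depends_on_thetaq S : depends_on S (thetaq S).
Proof.
move=> E E' h; congr (_ * _); first exact: depends_on_theta.
by apply: eq_bigr => d /h ->.
Qed.

Lemma thetaq_le S E : thetaq S E <= (2 * #|S|)%:R * theta S E.
Proof.
rewrite /thetaq [leLHS]mulrC ler_wpM2r ?theta_ge0//.
rewrite mulnC natrM mulr_natl -sumr_const.
apply: ler_sum => d _; have := p_ge0.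
by case: (d \notin E) => /=; lra.
Qed.

(** Bounds the factors of the edges of A by their largest value. *)
Lemma theta_setD_le S A E : theta S E <= 2 ^+ #|S| * theta (S :\: A) E.
Proof.
rewrite -prodr_const /theta [in leRHS](big_setID A) /=.
rewrite [leLHS](big_setID A) /= -mulrA; apply: ler_pM.
- by apply: prodr_ge0 => d _; rewrite addr_ge0.
- by apply: prodr_ge0 => d _; rewrite addr_ge0.
- apply: ler_prod => d _; rewrite addr_ge0//=.
  by case: (_ \in _) => /=; have /andP[_ ?] := p01; lra.
rewrite ler_peMl ?theta_ge0//.
by rewrite prodr_const exprn_ege1// ler1n.
Qed.

Lemma Ex_theta S : {in S, forall d, P d = p} -> Ex (theta S) = (2 * p) ^+ #|S|.
Proof.
move=> PS; rewrite /theta (Ex_prod_in S (fun _ b => p + b%:R)) -prodr_const.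
by apply: eq_bigr => d /PS -> /=; ring.
Qed.

Lemma Ex_thetaq_le S : {in S, forall d, P d = p} ->
  Ex (thetaq S) <= (2 * #|S|)%:R * (1 - p) * (2 * p) ^+ #|S|.
Proof.
move=> PS; have p2 : 0 <= 2 * p by rewrite mulr_ge0.
have miss d0 : d0 \in S ->
    Ex (fun E => theta S E * (d0 \notin E)%:R) <= (1 - p) * (2 * p) ^+ #|S|.
  move=> d0S.
  apply: (@le_trans _ _ (Ex (fun E => \prod_(d in S) ((p + (d \in E)%:R) *
      (if d == d0 then (~~ (d \in E))%:R else 1))))).
    apply: le_of_eq; apply: eq_Ex => E.
    rewrite big_split /=; congr (_ * _).
    by rewrite (bigD1 d0) //= eqxx big1 ?mulr1 // => d /andP[_ /negbTE ->].
  rewrite (Ex_prod_in S (fun d b => (p + b%:R) * (if d == d0 then (~~ b)%:R else 1))).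
  rewrite (bigD1 d0) //= eqxx PS // -prodr_const [in leRHS](bigD1 d0) //=.
  rewrite !mulr0 add0r mulr1 addr0 [leRHS]mulrA.
  apply: ler_pM.
  - by have := p_ge0; have := q_ge0; nra.
  - apply: prodr_ge0 => d /andP[/PS -> /negbTE ->].
    by have := p_ge0; have := q_ge0; rewrite /=; nra.
  - by have := p_ge0; have := q_ge0; rewrite /=; nra.
  apply: ler_prod => d /andP[/PS -> /negbTE ->].
  by have := p_ge0; have := q_ge0; rewrite /= => *; apply/andP; split; nra.
apply: (@le_trans _ _ (\sum_(d0 in S) (2 * ((1 - p) * (2 * p) ^+ #|S|)))); last first.
  rewrite sumr_const -mulr_natl natrM; lra.
rewrite (_ : Ex (thetaq S) = \sum_(d0 in S)
    Ex (fun E => theta S E * ((1 - p) + (d0 \notin E)%:R))); last first.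
  by rewrite -Ex_sum; apply: eq_Ex => E; rewrite -mulr_sumr.
apply: ler_sum => d0 d0S; under eq_Ex => E do rewrite mulrDr.
rewrite ExD ExZr Ex_theta//; have := miss d0 d0S; lra.
Qed.

Lemma dist_present_le S E E' : `|present S E - present S E'| <=
  (\prod_(d in S) ((d \in E)%:R + (d \in E')%:R)) *
  \sum_(d in S) ((d \notin E)%:R + (d \notin E')%:R).
Proof.
have nn : 0 <= (\prod_(d in S) ((d \in E)%:R + (d \in E')%:R)) *
    \sum_(d in S) ((d \notin E)%:R + (d \notin E')%:R) :> R.
  by rewrite mulr_ge0 ?prodr_ge0 ?sumr_ge0// => d _; rewrite addr_ge0.
have key A B : S \subset A -> ~~ (S \subset B) ->
    1 <= (\prod_(d in S) ((d \in A)%:R + (d \in B)%:R)) *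
      \sum_(d in S) ((d \notin A)%:R + (d \notin B)%:R) :> R.
  move=> /fintype.subsetP SA /fintype.subsetPn[d0 d0S d0B].
  rewrite -[leLHS]mulr1; apply: ler_pM => //.
    apply: (big_ind (fun x : R => 1 <= x)) => [|x y|d /SA ->];
      [exact: lexx|exact: mulr_ege1|by rewrite lerDl].
  rewrite (bigD1 d0) //= d0B (SA _ d0S) /= add0r lerDl.
  by rewrite sumr_ge0 // => d _; rewrite addr_ge0.
rewrite /present; have [SE|SE] := boolP (S \subset E).
  have [SE'|SE'] := boolP (S \subset E').
    by rewrite subrr normr0.
  by rewrite subr0 normr1 key.
have [SE'|SE'] := boolP (S \subset E'); last by rewrite subrr normr0.
rewrite sub0r normrN normr1.
under eq_bigr => d _ do rewrite addrC.
under [X in _ * X]eq_bigr => d _ do rewrite addrC.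
exact: key.
Qed.

(** Resampling the edges of S changes two indicators only if the edges of both
    sets are present before or after, and some edge of S is missing before or
    after; averaging over the resampled edges gives thetaq. *)
Lemma Ex_resample_le S T E : {in S, forall d, P d = p} ->
  Ex (fun E' => `|present S E - present S E'| *
                `|present T E - present T (mix S E E')|)
  <= (2 ^+ #|S :|: T|) * thetaq (S :|: T) E.
Proof.
move=> PS.
(* bounds the product of the factors that d contributes to the two indicators,
   where b tells whether the resampled d is present *)
pose c d (b : bool) : R := 2 * ((d \in E)%:R + (d \in S)%:R * b%:R).
have c_ge0 d b : 0 <= c d b by rewrite mulr_ge0 ?addr_ge0 ?mulr_ge0.
have PU E' : (\prod_(d in S) ((d \in E)%:R + (d \in E')%:R)) *
    (\prod_(d in T) ((d \in E)%:R + (d \in mix S E E')%:R)) <=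
    \prod_(d in S :|: T) c d (d \in E').
  rewrite (big_mkcond (mem S)) (big_mkcond (mem T)) (big_mkcond (mem (S :|: T))).
  rewrite -big_split /=; apply: ler_prod => d _; rewrite /c in_mix inE.
  by case: (d \in S); case: (d \in T); case: (d \in E); case: (d \in E');
     rewrite /=; lra.
have step E' : `|present S E - present S E'| *
      `|present T E - present T (mix S E E')| <=
    \sum_(d0 in S) (((d0 \notin E)%:R + (d0 \notin E')%:R) *
      \prod_(d in S :|: T) c d (d \in E')).
  set s1 := `|present S E - present S E'|.
  have h1 : s1 <= _ := dist_present_le S E E'.
  have h2 : `|present T E - present T (mix S E E')| <=
      \prod_(d in T) ((d \in E)%:R + (d \in mix S E E')%:R).
    have key (A B : {set D}) : T \subset A ->
        1 <= \prod_(d in T) ((d \in A)%:R + (d \in B)%:R) :> R.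
      move=> /fintype.subsetP TA.
      apply: (big_ind (fun x : R => 1 <= x)) => [|x y|d /TA ->];
      [exact: lexx|exact: mulr_ege1|by rewrite lerDl].
    have nn : 0 <= \prod_(d in T) ((d \in E)%:R + (d \in mix S E E')%:R) :> R.
      by apply: prodr_ge0 => d _; rewrite addr_ge0.
    rewrite /present; have [TE|TE] := boolP (T \subset E).
      have := key E (mix S E E') TE.
      by case: (T \subset _); rewrite ?subrr ?normr0 // subr0 normr1.
    have [TE'|TE'] := boolP (T \subset mix S E E'); last by rewrite subrr normr0.
    rewrite sub0r normrN normr1.
    by under eq_bigr => d _ do rewrite addrC; exact: key.
  apply: le_trans (ler_pM (normr_ge0 _) (normr_ge0 _) h1 h2) _.
  rewrite -mulr_suml.
  set s2 := \sum_(_ in _) _.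
  have s2_ge0 : 0 <= s2 by apply: sumr_ge0 => d _; rewrite addr_ge0.
  rewrite [X in X * _]mulrC -mulrA.
  by rewrite ler_wpM2l.
apply: le_trans (le_Ex step) _; rewrite Ex_sum.
have c_avg : Ex (fun E' => \prod_(d in S :|: T) c d (d \in E')) <=
    2 ^+ #|S :|: T| * theta (S :|: T) E.
  rewrite (Ex_prod_in (S :|: T) c) /theta -prodr_const -big_split /=.
  apply: ler_prod => d _; rewrite /c; have /andP[? ?] := P01 d.
  have [dS|dS] := boolP (d \in S); first rewrite PS //.
    by case: (d \in E) => /=; have := p_ge0; have := q_ge0 => *; apply/andP; split; nra.
  by case: (d \in E) => /=; have := p_ge0; have := q_ge0 => *; apply/andP; split; nra.
have miss d0 : d0 \in S ->
    Ex (fun E' => (d0 \notin E')%:R * \prod_(d in S :|: T) c d (d \in E')) <=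
    (1 - p) * (2 ^+ #|S :|: T| * theta (S :|: T) E).
  move=> d0S; have d0U : d0 \in S :|: T by rewrite inE d0S.
  pose h d (b : bool) : R := c d b * (if d == d0 then (~~ b)%:R else 1).
  rewrite (_ : Ex _ = Ex (fun E' => \prod_(d in S :|: T) h d (d \in E'))); last first.
    apply: eq_Ex => E'; rewrite [RHS]big_split /= [RHS]mulrC; congr (_ * _).
    by rewrite [RHS](bigD1 d0) //= eqxx big1 ?mulr1 // => d /andP[_ /negbTE ->].
  rewrite (Ex_prod_in (S :|: T) h) /theta -prodr_const -big_split /=.
  rewrite (bigD1 d0) //= [in leRHS](bigD1 d0) //= [leRHS]mulrA.
  apply: ler_pM.
  - have /andP[? ?] := P01 d0.
    by rewrite addr_ge0 ?mulr_ge0 ?subr_ge0 //; case: ifP.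
  - apply: prodr_ge0 => d _; have /andP[? ?] := P01 d.
    by rewrite addr_ge0 ?mulr_ge0 ?subr_ge0 //; case: ifP.
  - rewrite /h /c eqxx d0S PS //=.
    by case: (d0 \in E) => /=; have := p_ge0; have := q_ge0; nra.
  apply: ler_prod => d /andP[_ /negbTE dd0]; rewrite /h /c dd0.
  have /andP[? ?] := P01 d.
  have [dS|dS] := boolP (d \in S); first rewrite PS //.
    by case: (d \in E) => /=; have := p_ge0; have := q_ge0 => *; apply/andP; split; nra.
  by case: (d \in E) => /=; have := p_ge0; have := q_ge0 => *; apply/andP; split; nra.
apply: (@le_trans _ _ (\sum_(d0 in S)
    (((1 - p) + (d0 \notin E)%:R) * (2 ^+ #|S :|: T| * theta (S :|: T) E)))).
  apply: ler_sum => d0 d0S.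
  under eq_Ex => E' do rewrite mulrDl.
  rewrite ExD ExZ mulrDl addrC; apply: lerD; first exact: miss.
  exact: ler_wpM2l.
rewrite -mulr_suml /thetaq.
have sub : \sum_(d0 in S) ((1 - p) + (d0 \notin E)%:R) <=
    \sum_(d0 in S :|: T) ((1 - p) + (d0 \notin E)%:R).
  rewrite [leRHS](big_setID S) /= finset.setUK lerDl.
  exact: miss_ge0.
rewrite mulrA [leRHS]mulrC.
by rewrite ler_wpM2r// mulr_ge0 ?theta_ge0// exprn_ge0.
Qed.

End ProductSpace.

(** * Families of edge sets with few overlaps *)

Section SparseFamilies.
Variables (R : realType) (D : finType) (K : {set D}) (p : R).
Hypothesis p01 : 0 <= p <= 1.
Implicit Types (A B U V S E : {set D}).

Let p_ge0 : 0 <= p. Proof. by case/andP: p01. Qed.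
Let q_ge0 : 0 <= 1 - p. Proof. by rewrite subr_ge0; case/andP: p01. Qed.

Definition meets A B : bool := ~~ [disjoint A & B].

Lemma meetsC A B : meets A B = meets B A.
Proof. by rewrite /meets disjoint_sym. Qed.

Lemma meetsUl A B U : meets (A :|: B) U = meets A U || meets B U.
Proof. by rewrite /meets -!setI_eq0 finset.setIUl finset.setU_eq0 negb_and. Qed.

Lemma meetsUr A B U : meets U (A :|: B) = meets U A || meets U B.
Proof. by rewrite meetsC meetsUl !(meetsC U). Qed.

(** The expected number of members of the family that are present is at most a,
    and at most b u after u edges have been added for free and only the
    members using one of them are counted. *)
Record sparse (J : finType) (r : pred J) (T : J -> {set D}) (L : nat)
    (a : R) (b : nat -> R) : Prop := Sparse {
  sparse_sub : forall j, T j \subset K;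
  sparse_card : forall j, (#|T j| <= L)%N;
  sparse_sum : \sum_(j | r j) p ^+ #|T j| <= a;
  sparse_meet : forall u U, U \subset K -> (#|U| <= u)%N ->
    \sum_(j | r j && meets (T j) U) p ^+ #|T j :\: U| <= b u }.

Lemma card_setUD A B : #|A :|: B| = (#|A| + #|B :\: A|)%N.
Proof.
rewrite -(cardsID A (A :|: B)) finset.setUK; congr (_ + _)%N.
by rewrite finset.setDUl finset.setDv finset.set0U.
Qed.

Lemma card_setUDD A B U :
  #|(A :|: B) :\: U| = (#|A :\: U| + #|B :\: (U :|: A)|)%N.
Proof.
rewrite finset.setDUl card_setUD; congr (_ + _)%N; apply: eq_card => d.
by rewrite !inE; case: (d \in U); case: (d \in A); case: (d \in B).
Qed.

(** The union of two members that share an edge is built by attaching the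
    second one to the first, so its weight is a times one overlap; if it has
    to meet U then both attachments are overlaps. *)
Lemma sparse_pairs (I : finType) (S : I -> {set D}) L a b :
  sparse predT S L a b -> (forall u, 0 <= b u) ->
  sparse (fun x : I * I => meets (S x.1) (S x.2))
    (fun x => S x.1 :|: S x.2) (2 * L) (a * b L)
    (fun u => 2 * (b u * b (u + L)%N)).
Proof.
move=> [sub card sum meet] b0; split.
- by move=> x; rewrite finset.subUset !sub.
- move=> x; apply: leq_trans (leq_card_setU _ _) _.
  by rewrite mul2n -addnn leq_add.
- rewrite -(pair_big_dep xpredT (fun i j => meets (S i) (S j))
    (fun i j => p ^+ #|S i :|: S j|)) /=.
  apply: (@le_trans _ _ (\sum_i p ^+ #|S i| * b L)); last first.
    by rewrite -mulr_suml ler_wpM2r.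
  apply: ler_sum => i _; under eq_bigr => j _ do rewrite card_setUD exprD.
  rewrite -mulr_sumr ler_wpM2l ?exprn_ge0//.
  by under eq_bigl => j do rewrite meetsC; exact: meet.
move=> u U UK Uu.
have half : \sum_(i | meets (S i) U) \sum_(j | meets (S j) (S i))
    p ^+ #|(S i :|: S j) :\: U| <= b u * b (u + L)%N.
  apply: (@le_trans _ _ (\sum_(i | meets (S i) U) p ^+ #|S i :\: U| * b (u + L)%N)).
    apply: ler_sum => i _; under eq_bigr => j _ do rewrite card_setUDD exprD.
    rewrite -mulr_sumr ler_wpM2l ?exprn_ge0//.
    apply: le_trans (meet (u + L)%N (U :|: S i) _ _).
    - rewrite [leRHS](bigID (fun j => meets (S j) (S i))) /=.
      rewrite [leLHS](eq_bigl (fun j => meets (S j) (U :|: S i) && meets (S j) (S i))).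
        by rewrite lerDl sumr_ge0// => j _; rewrite exprn_ge0.
      by move=> j; rewrite meetsUr; case: (meets (S j) (S i)); rewrite ?orbT ?andbF.
    - by rewrite finset.subUset UK sub.
    - by apply: leq_trans (leq_card_setU _ _) _; rewrite leq_add.
  by rewrite -mulr_suml ler_wpM2r//; exact: meet.
pose F (x : I * I) := p ^+ #|(S x.1 :|: S x.2) :\: U|.
have F0 x : 0 <= F x by rewrite exprn_ge0.
apply: (@le_trans _ _ (\sum_(x | meets (S x.1) U && meets (S x.2) (S x.1)) F x +
                       \sum_(x | meets (S x.2) U && meets (S x.1) (S x.2)) F x)).
  rewrite (big_mkcond (fun x => _ && meets (S x.2) (S x.1))).
  rewrite (big_mkcond (fun x => _ && meets (S x.1) (S x.2))) -big_split /=.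
  rewrite big_mkcond; apply: ler_sum => x _.
  rewrite meetsUl (meetsC (S x.2) (S x.1)) -/(F x).
  case: (meets (S x.1) (S x.2)); case: (meets (S x.1) U);
    case: (meets (S x.2) U) => //=; rewrite ?addr0 ?add0r ?lerDl ?F0//.
rewrite mulr2n mulrDl mul1r; apply: lerD.
  by rewrite -(pair_big_dep (fun i => meets (S i) U)
    (fun i j => meets (S j) (S i)) (fun i j => F (i, j))).
rewrite (reindex_inj (h := fun x : I * I => (x.2, x.1))) /=; last first.
  by move=> [i j] [i' j'] /= [-> ->].
rewrite -(pair_big_dep (fun i => meets (S i) U)
    (fun i j => meets (S j) (S i)) (fun i j => F (j, i))) /=.
by under eq_bigr => i _ do under eq_bigr => j _ do rewrite /F /= finset.setUC.
Qed.

Variable P : D -> R.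
Hypothesis P01 : forall d, 0 <= P d <= 1.
Hypothesis PK : {in K, forall d, P d = p}.

Section OverlapSum.
Variables (J : finType) (r : pred J) (T : J -> {set D}).
Variables (L : nat) (a b : R) (cb : nat -> R).
Hypothesis spT : sparse r T L a (fun u => cb u * b).
Hypothesis a_ge0 : 0 <= a.
Hypothesis b_ge0 : 0 <= b.
Hypothesis cb_ge0 : forall u, 0 <= cb u.

(** The sum of thetaq over the family, after the states of the edges of U have
    been replaced by worst-case ones: it depends only on the edges outside U. *)
Definition overlap_sum U E : R :=
  \sum_(j | r j) if meets (T j) U then theta p (T j :\: U) E
                 else thetaq p (T j) E.

Lemma overlap_sum_ge0 U E : 0 <= overlap_sum U E.
Proof.
by apply: sumr_ge0 => j _; case: ifP => _; rewrite ?theta_ge0 ?thetaq_ge0.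
Qed.

Let cov : R := (2 * L).+1%:R * 2 ^+ L.

Let cov_ge0 : 0 <= cov. Proof. by rewrite mulr_ge0 ?exprn_ge0. Qed.

(** Treating more edges as worst-case costs a constant factor. *)
Lemma overlap_sum_setU U V E : overlap_sum U E <= cov * overlap_sum (U :|: V) E.
Proof.
have e1 : 1 <= 2 ^+ L :> R by rewrite exprn_ege1// ler1n.
have e2 : 1 <= (2 * L).+1%:R :> R by rewrite ler1n.
have cov1 : 1 <= cov by exact: mulr_ege1.
have drop j A : theta p (T j) E <= 2 ^+ L * theta p (T j :\: A) E.
  apply: le_trans (theta_setD_le p01 _ A _) _.
  by rewrite ler_wpM2r ?theta_ge0// ler_weXn2l ?ler1n// (sparse_card spT).
rewrite /overlap_sum mulr_sumr; apply: ler_sum => j _.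
rewrite meetsUr; have [_|_] := boolP (meets (T j) U) => /=.
  rewrite -finset.setDDl; apply: le_trans (theta_setD_le p01 _ V _) _.
  rewrite ler_wpM2r ?theta_ge0//.
  apply: (@le_trans _ _ (2 ^+ L)); last by rewrite ler_peMl// (le_trans ler01).
  rewrite ler_weXn2l ?ler1n//.
  by rewrite (leq_trans _ (sparse_card spT j))// subset_leq_card// finset.subsetDl.
have [_|_] := boolP (meets (T j) V); last by rewrite ler_peMl// thetaq_ge0.
apply: le_trans (thetaq_le p01 _ _) _; rewrite -mulrA; apply: ler_pM => //.
- exact: theta_ge0.
- by rewrite ler_nat; have := sparse_card spT j; lia.
Qed.

Lemma depends_on_overlap_sum U : depends_on (~: U) (overlap_sum U).
Proof.
move=> E E' h; apply: eq_bigr => j _; case: ifP => [_|].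
  apply: depends_on_theta => d; rewrite inE => /andP[dU _].
  by apply: h; rewrite inE.
move=> /negbFE jU; apply: depends_on_thetaq => d dT; apply: h; rewrite inE.
by apply/negP => dU; move/pred0P/(_ d): jU; rewrite /= dT dU.
Qed.

(** Each factor of the power either misses the edges used so far, at the price
    q a, or meets them; the remaining power is then evaluated with these edges
    worst-case, hence independently of the factor. *)
Lemma overlap_moment_step m u U M : U \subset K -> (#|U| <= u)%N -> 0 <= M ->
  (forall U', U' \subset K -> (#|U'| <= u + L)%N ->
    Ex P (fun E => overlap_sum U' E ^+ m) <= M) ->
  Ex P (fun E => overlap_sum U E ^+ m.+1) <=
  cov ^+ m * M * 2 ^+ L * ((2 * L)%:R * ((1 - p) * a) +
    \sum_(j | r j && meets (T j) U) p ^+ #|T j :\: U|).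
Proof.
move=> UK Uu M0 IH.
pose f j E := if meets (T j) U then theta p (T j :\: U) E else thetaq p (T j) E.
have f0 j E : 0 <= f j E by rewrite /f; case: ifP => _; rewrite ?theta_ge0 ?thetaq_ge0.
have dep_f j : depends_on (T j) (f j).
  move=> E E' h; rewrite /f; case: ifP => _; last exact: depends_on_thetaq.
  by apply: depends_on_theta => d /finset.setDP[/h].
have term j : Ex P (fun E => f j E * overlap_sum U E ^+ m) <=
    cov ^+ m * M * Ex P (f j).
  apply: (@le_trans _ _ (Ex P (fun E =>
      f j E * (cov ^+ m * overlap_sum (U :|: T j) E ^+ m)))).
    apply: le_Ex => // E; rewrite ler_wpM2l// -exprMn lerXn2r//.
    - by rewrite nnegrE overlap_sum_ge0.
    - by rewrite nnegrE mulr_ge0 ?overlap_sum_ge0.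
    - exact: overlap_sum_setU.
  rewrite (@Ex_indep _ _ P (T j) (~: (U :|: T j)) (f j)
    (fun E => cov ^+ m * overlap_sum (U :|: T j) E ^+ m)) //.
  - rewrite mulrC ler_wpM2r ?Ex_ge0// ExZ ler_wpM2l ?exprn_ge0//.
    apply: IH; first by rewrite finset.subUset UK (sparse_sub spT).
    by apply: leq_trans (leq_card_setU _ _) _; rewrite leq_add// (sparse_card spT).
  - by rewrite disjoint_sym finset.disjoints_subset finset.setCS finset.subsetUr.
  - by move=> E E' h; rewrite (depends_on_overlap_sum h).
rewrite (_ : Ex P _ = \sum_(j | r j) Ex P (fun E => f j E * overlap_sum U E ^+ m)); last first.
  by rewrite -Ex_sum; apply: eq_Ex => E; rewrite -mulr_suml exprS.
apply: (@le_trans _ _ (\sum_(j | r j) cov ^+ m * M * Ex P (f j))).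
  by apply: ler_sum => j _; exact: term.
have cM : 0 <= cov ^+ m * M by rewrite mulr_ge0 ?exprn_ge0.
rewrite -mulr_sumr -!mulrA ler_wpM2l ?exprn_ge0// ler_wpM2l//.
have PT j : {in T j, forall d, P d = p}.
  by move=> d dT; apply: PK; apply: (fintype.subsetP (sparse_sub spT j)).
have pow2 A j : A \subset T j -> (2 * p) ^+ #|A| <= 2 ^+ L * p ^+ #|A|.
  move=> AT; rewrite exprMn ler_wpM2r ?exprn_ge0// ler_weXn2l ?ler1n//.
  by rewrite (leq_trans _ (sparse_card spT j))// subset_leq_card.
rewrite (bigID (fun j => meets (T j) U)) /= addrC mulrDr; apply: lerD; last first.
  rewrite mulr_sumr; apply: ler_sum => j /andP[_ jU]; rewrite /f jU Ex_theta//.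
    by apply: pow2 (finset.subsetDl _ _).
  by move=> d; rewrite inE => /andP[_ /PT].
apply: (@le_trans _ _ (\sum_(j | r j) 2 ^+ L * ((2 * L)%:R * ((1 - p) * p ^+ #|T j|)))); last first.
  rewrite -mulr_sumr ler_wpM2l ?exprn_ge0// -mulr_sumr ler_wpM2l//.
  by rewrite -mulr_sumr ler_wpM2l// (sparse_sum spT).
rewrite [leRHS](bigID (fun j => meets (T j) U)) /= [leRHS]addrC.
rewrite -[leLHS]addr0; apply: lerD; last first.
  by apply: sumr_ge0 => j _; rewrite !mulr_ge0 ?exprn_ge0.
apply: ler_sum => j /andP[_ /negbTE jU]; rewrite /f jU.
apply: le_trans (Ex_thetaq_le p01 (PT j)) _.
rewrite [leRHS](_ : _ = (2 * L)%:R * (1 - p) * (2 ^+ L * p ^+ #|T j|)); last by ring.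
apply: ler_pM; rewrite ?mulr_ge0 ?exprn_ge0 ?mulr_ge0//.
  rewrite ler_wpM2r// ler_nat leq_mul2l /=.
  exact: (sparse_card spT).
exact: pow2.
Qed.

End OverlapSum.
End SparseFamilies.

(** Bounds the moment of order m of overlap_sum, when up to u edges are
    worst-case. *)
Fixpoint overlap_const (R : realType) (L : nat) (cb : nat -> R) (m u : nat) : R :=
  if m is m'.+1 then
    ((2 * L).+1%:R * 2 ^+ L) ^+ m' * overlap_const L cb m' (u + L) * 2 ^+ L *
      ((2 * L)%:R + cb u)
  else 1.

Lemma overlap_const_ge0 (R : realType) L (cb : nat -> R) m u :
  (forall u, 0 <= cb u) -> 0 <= overlap_const L cb m u.
Proof.
move=> cb0; elim: m u => [|m IH] u //=.
by rewrite !mulr_ge0 ?exprn_ge0 ?mulr_ge0 ?addr_ge0 ?exprn_ge0.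
Qed.

Section OverlapMoments.
Variables (R : realType) (D : finType) (K : {set D}) (p : R) (P : D -> R).
Hypothesis p01 : 0 <= p <= 1.
Hypothesis P01 : forall d, 0 <= P d <= 1.
Hypothesis PK : {in K, forall d, P d = p}.
Variables (J : finType) (r : pred J) (T : J -> {set D}).
Variables (L : nat) (a b : R) (cb : nat -> R).
Hypothesis spT : sparse K p r T L a (fun u => cb u * b).
Hypothesis a_ge0 : 0 <= a.
Hypothesis b_ge0 : 0 <= b.
Hypothesis cb_ge0 : forall u, 0 <= cb u.

Let q_ge0 : 0 <= 1 - p. Proof. by rewrite subr_ge0; case/andP: p01. Qed.
Let qab_ge0 : 0 <= (1 - p) * a + b.
Proof. by rewrite addr_ge0 ?mulr_ge0. Qed.

Lemma overlap_moment m u (U : {set D}) : U \subset K -> (#|U| <= u)%N ->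
  Ex P (fun E => overlap_sum p r T U E ^+ m) <=
  overlap_const L cb m u * ((1 - p) * a + b) ^+ m.
Proof.
elim: m u U => [|m IH] u U UK Uu.
  by under eq_Ex => E do rewrite expr0; rewrite Ex_cst mulr1.
have c0 := overlap_const_ge0 L m (u + L) cb_ge0.
apply: le_trans (overlap_moment_step p01 P01 PK spT a_ge0 b_ge0 UK Uu _ (IH (u + L)%N)) _ => //.
  by rewrite mulr_ge0 ?exprn_ge0.
rewrite /= exprS.
set c := overlap_const _ _ _ _ in c0 *; set X := (1 - p) * a + b; have X0 : 0 <= X := qab_ge0.
set e := (_ ^+ m); set s := \sum_(_ | _) _.
have e0 : 0 <= e by rewrite exprn_ge0// mulr_ge0 ?exprn_ge0.
rewrite [leRHS](_ : _ = e * (c * X ^+ m) * 2 ^+ L * (((2 * L)%:R + cb u) * X)); last by ring.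
apply: ler_wpM2l; first by rewrite !mulr_ge0 ?exprn_ge0.
have hs : s <= cb u * b := sparse_meet spT UK Uu.
rewrite [leRHS]mulrDl; apply: lerD; first by rewrite ler_wpM2l// lerDl.
by apply: le_trans hs _; rewrite ler_wpM2l// lerDr mulr_ge0.
Qed.

(** With no worst-case edge, the first factor of the power cannot be an
    overlap; this saves a factor (q a + b) / (q a), which the bound of the third
    moment by the fourth one needs. *)
Lemma overlap_moment0 m :
  Ex P (fun E => overlap_sum p r T finset.set0 E ^+ m.+1) <=
  overlap_const L cb m.+1 0 * (((1 - p) * a) * ((1 - p) * a + b) ^+ m).
Proof.
have c0 := overlap_const_ge0 L m (0 + L) cb_ge0.
have /(_ (finset.set0)) h := overlap_moment_step p01 P01 PK spT a_ge0 b_ge0 _ _ _ (@overlap_moment m (0 + L)%N).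
apply: le_trans (h _ _ _) _; rewrite ?finset.sub0set ?cards0//.
  by rewrite mulr_ge0 ?exprn_ge0.
rewrite big_pred0 => [|j]; last by rewrite /meets -finset.setI_eq0 finset.setI0 eqxx andbF.
rewrite addr0 /=.
set c := overlap_const _ _ _ _ in c0 *; set X := ((1 - p) * a + b) ^+ m.
set e := (_ ^+ m).
have e0 : 0 <= e by rewrite exprn_ge0// mulr_ge0 ?exprn_ge0.
have X0 : 0 <= X by rewrite exprn_ge0.
rewrite [leRHS](_ : _ = e * (c * X) * 2 ^+ L * (((2 * L)%:R + cb 0) * ((1 - p) * a))); last by ring.
apply: ler_wpM2l; first by rewrite !mulr_ge0 ?exprn_ge0.
by rewrite ler_wpM2r ?mulr_ge0// lerDl.
Qed.

End OverlapMoments.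

(** * Variance of sums of local functions *)

Section LocalSums.
Variables (R : realType) (D : finType) (K : {set D}) (p : R) (P : D -> R).
Hypothesis p01 : 0 <= p <= 1.
Hypothesis P01 : forall d, 0 <= P d <= 1.
Hypothesis PK : {in K, forall d, P d = p}.
Variables (J : finType) (r : pred J) (T : J -> {set D}).
Variables (L : nat) (a : R) (b : nat -> R).
Hypothesis spT : sparse K p r T L a b.
Hypothesis b_ge0 : 0 <= b L.

Let p_ge0 : 0 <= p. Proof. by case/andP: p01. Qed.
Let q_ge0 : 0 <= 1 - p. Proof. by rewrite subr_ge0; case/andP: p01. Qed.

Let PT j : {in T j, forall d, P d = p}.
Proof. by move=> d dT; apply: PK; apply: (fintype.subsetP (sparse_sub spT j)). Qed.

Let pow2 (A : {set D}) j : A \subset T j -> (2 * p) ^+ #|A| <= 2 ^+ L * p ^+ #|A|.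
Proof.
move=> AT; rewrite exprMn ler_wpM2r ?exprn_ge0// ler_weXn2l ?ler1n//.
by rewrite (leq_trans _ (sparse_card spT j))// subset_leq_card.
Qed.

Definition local_const : R := (2 * L)%:R * 2 ^+ L * ((2 * L)%:R * 2 ^+ L) * 2 ^+ L.

Lemma local_const_ge0 : 0 <= local_const.
Proof. by rewrite !mulr_ge0 ?exprn_ge0. Qed.

Let thetaq_cross i j E :
  thetaq p (T j) E <= (2 * L)%:R * 2 ^+ L * theta p (T j :\: T i) E.
Proof.
apply: le_trans (thetaq_le p01 _ _) _; rewrite -mulrA; apply: ler_pM => //.
- exact: theta_ge0.
- by rewrite ler_nat leq_mul2l (sparse_card spT).
apply: le_trans (theta_setD_le p01 _ (T i) _) _.
by rewrite ler_wpM2r ?theta_ge0// ler_weXn2l ?ler1n// (sparse_card spT).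
Qed.

Let Ex_thetaq_T i :
  Ex P (thetaq p (T i)) <= (2 * L)%:R * 2 ^+ L * ((1 - p) * p ^+ #|T i|).
Proof.
apply: le_trans (Ex_thetaq_le p01 (PT (j := i))) _.
rewrite [leRHS](_ : _ = (2 * L)%:R * (1 - p) * (2 ^+ L * p ^+ #|T i|)); last by ring.
apply: ler_pM; rewrite ?mulr_ge0 ?exprn_ge0 ?mulr_ge0//; last exact: pow2.
by rewrite ler_wpM2r// ler_nat leq_mul2l (sparse_card spT).
Qed.

Let Ex_theta_TD i j :
  Ex P (theta p (T j :\: T i)) <= 2 ^+ L * p ^+ #|T j :\: T i|.
Proof.
rewrite Ex_theta; first exact: (pow2 (finset.subsetDl _ _)).
by move=> d /finset.setDP[/PT].
Qed.

Let Ex_thetaq_mul i j :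
  Ex P (thetaq p (T i)) * Ex P (theta p (T j :\: T i)) * ((2 * L)%:R * 2 ^+ L) <=
  local_const * (1 - p) * (p ^+ #|T i| * p ^+ #|T j :\: T i|).
Proof.
have h : Ex P (thetaq p (T i)) * Ex P (theta p (T j :\: T i)) <=
    (2 * L)%:R * 2 ^+ L * ((1 - p) * p ^+ #|T i|) * (2 ^+ L * p ^+ #|T j :\: T i|).
  by apply: ler_pM; rewrite ?Ex_ge0// => E; rewrite ?theta_ge0 ?thetaq_ge0.
apply: le_trans (ler_wpM2r _ h) _; first by rewrite mulr_ge0 ?exprn_ge0.
by apply: le_of_eq; rewrite /local_const; ring.
Qed.

Lemma Ex_thetaq_thetaq i j : Ex P (fun E => thetaq p (T i) E * thetaq p (T j) E) <=
  local_const * (1 - p) * (p ^+ #|T i| * p ^+ #|T j :\: T i|).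
Proof.
apply: le_trans (Ex_thetaq_mul i j).
rewrite -(@Ex_indep _ _ P (T i) (T j :\: T i)).
- rewrite -ExZr; apply: le_Ex => // E; rewrite -[leRHS]mulrA.
  by rewrite ler_wpM2l ?thetaq_ge0// mulrC; exact: thetaq_cross.
- by rewrite -finset.setI_eq0 finset.setIDA finset.setDIl finset.setDv finset.set0I eqxx.
- exact: depends_on_thetaq.
- exact: depends_on_theta.
Qed.

Lemma Ex_thetaq_Ex_thetaq i j : Ex P (thetaq p (T i)) * Ex P (thetaq p (T j)) <=
  local_const * (1 - p) * (p ^+ #|T i| * p ^+ #|T j :\: T i|).
Proof.
apply: le_trans (Ex_thetaq_mul i j); rewrite -[leRHS]mulrA.
rewrite ler_wpM2l ?Ex_ge0// => [E|]; first exact: thetaq_ge0.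
by rewrite -ExZr; apply: le_Ex => // E; rewrite mulrC; exact: thetaq_cross.
Qed.

Variables (Y : J -> {set D} -> R) (cY : R).
Hypothesis depY : forall j, depends_on (T j) (Y j).
Hypothesis Y_le : forall j E, `|Y j E| <= cY * thetaq p (T j) E.

Let cov i j : R := Ex P (fun E => Y i E * Y j E) - Ex P (Y i) * Ex P (Y j).

Let cov_le i j : `|cov i j| <=
  2 * (cY ^+ 2 * (local_const * (1 - p) * (p ^+ #|T i| * p ^+ #|T j :\: T i|))).
Proof.
have EY k : `|Ex P (Y k)| <= cY * Ex P (thetaq p (T k)).
  by apply: le_trans (ler_norm_Ex P01 _) _; rewrite -ExZ; exact: le_Ex.
apply: le_trans (ler_normB _ _) _; rewrite mulr2n mulrDl mul1r; apply: lerD.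
  apply: le_trans (ler_norm_Ex P01 _) _.
  apply: (@le_trans _ _ (Ex P (fun E => cY ^+ 2 * (thetaq p (T i) E * thetaq p (T j) E)))).
    apply: le_Ex => // E; rewrite normrM.
    rewrite [leRHS](_ : _ = (cY * thetaq p (T i) E) * (cY * thetaq p (T j) E)); last by ring.
    by apply: ler_pM.
  by rewrite ExZ ler_wpM2l ?sqr_ge0// Ex_thetaq_thetaq.
rewrite normrM.
apply: (@le_trans _ _ (cY ^+ 2 * (Ex P (thetaq p (T i)) * Ex P (thetaq p (T j))))).
  rewrite [leRHS](_ : _ = (cY * Ex P (thetaq p (T i))) * (cY * Ex P (thetaq p (T j)))); last by ring.
  by apply: ler_pM.
by rewrite ler_wpM2l ?sqr_ge0// Ex_thetaq_Ex_thetaq.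
Qed.

(** Only pairs of terms that share an edge are correlated. *)
Lemma variance_local_sum :
  Ex P (fun E => (\sum_(j | r j) Y j E -
                  Ex P (fun E => \sum_(j | r j) Y j E)) ^+ 2) <=
  2 * cY ^+ 2 * local_const * ((1 - p) * (a * b L)).
Proof.
pose m := Ex P (fun E => \sum_(j | r j) Y j E).
have -> : Ex P (fun E => (\sum_(j | r j) Y j E - m) ^+ 2) =
    \sum_(i | r i) \sum_(j | r j) cov i j.
  transitivity (Ex P (fun E => (\sum_(i | r i) Y i E) * (\sum_(j | r j) Y j E)) - m * m).
    rewrite (_ : Ex P _ = Ex P (fun E =>
       (\sum_(i | r i) Y i E) * (\sum_(j | r j) Y j E) -
       (2 * m) * (\sum_(j | r j) Y j E) + m * m)); last first.
      by apply: eq_Ex => E; ring.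
    by rewrite ExD ExB ExZ Ex_cst -/m; ring.
  rewrite /m Ex_sum mulr_suml; under eq_Ex => E do rewrite mulr_suml.
  rewrite Ex_sum -sumrB; apply: eq_bigr => i _.
  rewrite mulr_sumr; under eq_Ex => E do rewrite mulr_sumr.
  by rewrite Ex_sum -sumrB.
have cov0 i j : ~~ meets (T j) (T i) -> cov i j = 0.
  move=> /negPn ij; rewrite /cov (@Ex_indep _ _ P (T i) (T j)) ?subrr//.
  by rewrite disjoint_sym.
set c := 2 * cY ^+ 2 * local_const.
have c0 : 0 <= c.
  by apply: mulr_ge0; [rewrite mulr_ge0 ?sqr_ge0|exact: local_const_ge0].
apply: (@le_trans _ _ (\sum_(i | r i) (c * (1 - p) * b L) * p ^+ #|T i|)); last first.
  rewrite -mulr_sumr [leRHS](_ : _ = (c * (1 - p) * b L) * a); last by ring.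
  by apply: ler_wpM2l; [do 2?apply: mulr_ge0|exact: sparse_sum spT].
apply: ler_sum => i _; rewrite (bigID (fun j => meets (T j) (T i))) /=.
rewrite [X in _ + X]big1 ?addr0 => [|j /andP[_ /cov0//]].
apply: (@le_trans _ _ (\sum_(j | r j && meets (T j) (T i))
    (c * (1 - p) * p ^+ #|T i|) * p ^+ #|T j :\: T i|)).
  apply: ler_sum => j _; apply: le_trans (ler_norm _) _.
  by apply: le_trans (cov_le i j) _; apply: le_of_eq; rewrite /c; ring.
rewrite -mulr_sumr [leRHS](_ : _ = (c * (1 - p) * p ^+ #|T i|) * b L); last by ring.
apply: ler_wpM2l; first by do 2?apply: mulr_ge0 => //; rewrite exprn_ge0.
by apply: (sparse_meet spT); [exact: sparse_sub spT i|exact: sparse_card spT i].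
Qed.

End LocalSums.

(** * Resampling the edges of one copy *)

(** Serves to absorb b^(m+1) / c, for a large c. Each of the two terms bounds
    the product in one of the cases c a <= b and b <= c a. *)
Lemma mul_exp_le (R : realFieldType) (a b c : R) m : 0 <= a -> 0 <= b -> 0 < c ->
  a * b ^+ m <= b ^+ m.+1 / c + c ^+ m * a ^+ m.+1.
Proof.
move=> a0 b0 c0; have [ab|/ltW ba] := leP (c * a) b.
  apply: (@le_trans _ _ (b ^+ m.+1 / c)); last first.
    by rewrite lerDl mulr_ge0 ?exprn_ge0// ltW.
  rewrite ler_pdivlMr// exprS mulrAC ler_wpM2r ?exprn_ge0//; lra.
apply: (@le_trans _ _ (c ^+ m * a ^+ m.+1)); last first.
  by rewrite lerDr divr_ge0 ?exprn_ge0// ltW.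
rewrite exprS mulrCA -exprMn ler_wpM2l// lerXn2r ?nnegrE ?mulr_ge0//; exact: ltW.
Qed.

Lemma dist_exp_odd_le (R : realFieldType) (x y : R) m :
  `|x ^+ (2 * m).+1 - y ^+ (2 * m).+1| <=
  (2 * m).+1%:R * (`|x - y| * (x ^+ (2 * m) + y ^+ (2 * m))).
Proof.
rewrite subrXX normrM mulrCA ler_wpM2l//.
apply: le_trans (ler_norm_sum _ _ _) _.
rewrite -[X in X%:R]card_ord mulr_natl -sumr_const; apply: ler_sum => i _.
have ev z : `|z| ^+ (2 * m) = z ^+ (2 * m) :> R.
  by rewrite !exprM real_normK// num_real.
rewrite normrM !normrX /=.
have im : (2 * m - i + i = 2 * m)%N by rewrite subnK// -ltnS.
have [xy|/ltW yx] := leP `|x| `|y|.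
  apply: (@le_trans _ _ (`|y| ^+ (2 * m - i) * `|y| ^+ i)).
    by rewrite ler_wpM2r ?exprn_ge0// lerXn2r ?nnegrE.
  by rewrite -exprD im ev lerDr exprM exprn_ge0 ?sqr_ge0.
apply: (@le_trans _ _ (`|x| ^+ (2 * m - i) * `|x| ^+ i)).
  by rewrite ler_wpM2l ?exprn_ge0// lerXn2r ?nnegrE.
by rewrite -exprD im ev lerDl exprM exprn_ge0 ?sqr_ge0.
Qed.

Section ResampledCopies.
Variables (R : realType) (D : finType) (K : {set D}) (p : R) (P : D -> R).
Hypothesis p01 : 0 <= p <= 1.
Hypothesis P01 : forall d, 0 <= P d <= 1.
Hypothesis PK : {in K, forall d, P d = p}.
Variables (I : finType) (S : I -> {set D}).
Variables (L : nat) (A B : R) (cb : nat -> R).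
Hypothesis spS : sparse K p predT S L A (fun u => cb u * B).
Hypothesis A_ge0 : 0 <= A.
Hypothesis B_ge0 : 0 <= B.
Hypothesis cb_ge0 : forall u, 0 <= cb u.
Implicit Types (E M : {set D}).

Let p_ge0 : 0 <= p. Proof. by case/andP: p01. Qed.
Let q_ge0 : 0 <= 1 - p. Proof. by rewrite subr_ge0; case/andP: p01. Qed.

Let PS i : {in S i, forall d, P d = p}.
Proof. by move=> d dS; apply: PK; apply: (fintype.subsetP (sparse_sub spS i)). Qed.

Definition copy_sum E : R := \sum_i (present R (S i) E - p ^+ #|S i|).

Local Notation W := copy_sum.

Definition jump i E M : R := present R (S i) E - present R (S i) M.

Let jumpN i E M : jump i M E = - jump i E M.
Proof. by rewrite /jump opprB. Qed.

Lemma copy_sum_diff E M : W E - W M = \sum_i jump i E M.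
Proof. by rewrite -sumrB; apply: eq_bigr => i _; rewrite /jump; ring. Qed.

Let jump0 i j E E' : ~~ meets (S i) (S j) -> jump j E (mix (S i) E E') = 0.
Proof.
move=> /negPn ij; apply/eqP; rewrite subr_eq0; apply/eqP.
apply: depends_on_present => d dj; rewrite in_mix; case: ifP => // di.
by move/pred0P/(_ d): ij; rewrite /= di dj.
Qed.

Let jump_mix i E E' : jump i E (mix (S i) E E') = present R (S i) E - present R (S i) E'.
Proof.
congr (_ - _); apply: depends_on_present => d di.
by rewrite in_mix di.
Qed.

(** The two halves of the difference contribute equally, by exchangeability. *)
Lemma Ex2_antisym i (kappa : {set D} -> {set D} -> R) (u : {set D} -> R) :
  (forall E M, kappa M E = - kappa E M) ->
  Ex2 P (fun E E' => kappa E (mix (S i) E E') * (u E - u (mix (S i) E E'))) =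
  2 * Ex2 P (fun E E' => kappa E (mix (S i) E E') * u E).
Proof.
move=> kN.
have e : Ex2 P (fun E E' => kappa E (mix (S i) E E') * u (mix (S i) E E')) =
   - Ex2 P (fun E E' => kappa E (mix (S i) E E') * u E).
  rewrite (Ex2_exchange P (S i) (fun E M => kappa E M * u M)).
  rewrite /Ex2 -ExN; apply: eq_Ex => E; rewrite -ExN; apply: eq_Ex => E'.
  by rewrite kN mulNr.
rewrite mulr2n mulrDl mul1r -[X in _ + X]opprK -e /Ex2 -ExB.
by apply: eq_Ex => E; rewrite -ExB; apply: eq_Ex => E'; rewrite mulrBr.
Qed.

(** Resampling the edges of one copy leaves the law of the pair symmetric, and
    the resampled indicator is independent of the original graph. *)
Lemma stein_identity (u : {set D} -> R) :
  Ex P (fun E => W E * u E) =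
  2^-1 * \sum_i Ex2 P (fun E E' =>
    jump i E (mix (S i) E E') * (u E - u (mix (S i) E E'))).
Proof.
rewrite (_ : Ex P _ = \sum_i Ex P (fun E =>
    (present R (S i) E - p ^+ #|S i|) * u E)); last first.
  by rewrite -Ex_sum; apply: eq_Ex => E; rewrite mulr_suml.
rewrite mulr_sumr; apply: eq_bigr => i _.
rewrite (Ex2_antisym i (kappa := jump i)); last exact: jumpN.
rewrite mulrA mulVf ?mul1r ?pnatr_eq0//; apply: eq_Ex => E.
rewrite ExZr; congr (_ * _).
under eq_Ex => E' do rewrite jump_mix.
by rewrite ExB Ex_cst (Ex_present (PS (i := i))).
Qed.

Definition meeting_pair (x : I * I) : bool := meets (S x.1) (S x.2).
Definition pair_union (x : I * I) : {set D} := S x.1 :|: S x.2.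

Local Notation r := meeting_pair.
Local Notation T := pair_union.

Let spT : sparse K p r T (2 * L) (A * (cb L * B))
  (fun u => 2 * (cb u * cb (u + L)%N) * B ^+ 2).
Proof.
have [|h1 h2 h3 h4] := sparse_pairs p01 spS; first by move=> u; rewrite mulr_ge0.
split=> // u U UK Uu; apply: le_trans (h4 u U UK Uu) _.
by apply: le_of_eq; ring.
Qed.

(** The averages over the resampled edges whose sums govern the error in
    Stein's method: square_sum / V should be close to 1 and signed_sum / V close
    to 0, where V is the variance. *)
Definition square_term (x : I * I) E : R := Ex P (fun E' =>
  jump x.1 E (mix (S x.1) E E') * jump x.2 E (mix (S x.1) E E')).

Definition signed_term (x : I * I) E : R := Ex P (fun E' =>
  `|jump x.1 E (mix (S x.1) E E')| * jump x.2 E (mix (S x.1) E E')).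

Definition abs_term (x : I * I) E : R := Ex P (fun E' =>
  `|jump x.1 E (mix (S x.1) E E')| * `|jump x.2 E (mix (S x.1) E E')|).

Lemma abs_term_le x E : abs_term x E <= 2 ^+ (2 * L) * thetaq p (T x) E.
Proof.
have h := Ex_resample_le P01 p01 (S x.2) E (PS (i := x.1)).
apply: (@le_trans _ _ (2 ^+ #|T x| * thetaq p (T x) E)).
  apply: le_trans h; apply: le_of_eq.
  by apply: eq_Ex => E'; rewrite jump_mix.
rewrite ler_wpM2r ?thetaq_ge0// ler_weXn2l ?ler1n//.
exact: (sparse_card spT).
Qed.

Lemma square_term_le x E : `|square_term x E| <= 2 ^+ (2 * L) * thetaq p (T x) E.
Proof.
apply: le_trans (abs_term_le x E); apply: le_trans (ler_norm_Ex P01 _) _.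
by apply: le_Ex => // E'; rewrite normrM.
Qed.

Lemma signed_term_le x E : `|signed_term x E| <= 2 ^+ (2 * L) * thetaq p (T x) E.
Proof.
apply: le_trans (abs_term_le x E); apply: le_trans (ler_norm_Ex P01 _) _.
by apply: le_Ex => // E'; rewrite normrM normr_id.
Qed.

Let jump_dep x E E1 E' : {in T x, forall d, (d \in E) = (d \in E1)} ->
  jump x.1 E (mix (S x.1) E E') = jump x.1 E1 (mix (S x.1) E1 E') /\
  jump x.2 E (mix (S x.1) E E') = jump x.2 E1 (mix (S x.1) E1 E').
Proof.
move=> h; split; congr (_ - _); apply: depends_on_present => d dS;
  by rewrite ?in_mix h // /pair_union inE dS ?orbT.
Qed.

Lemma depends_on_square_term x : depends_on (T x) (square_term x).
Proof. by move=> E E1 h; apply: eq_Ex => E'; have [-> ->] := jump_dep E' h. Qed.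

Lemma depends_on_signed_term x : depends_on (T x) (signed_term x).
Proof. by move=> E E1 h; apply: eq_Ex => E'; have [-> ->] := jump_dep E' h. Qed.

Definition square_sum E : R := 2^-1 * \sum_(x | r x) square_term x E.
Definition signed_sum E : R := \sum_(x | r x) signed_term x E.

Let sum_pairs (F : I -> {set D} -> {set D} -> R) E :
  \sum_(x | r x) Ex P (fun E' => F x.1 E (mix (S x.1) E E') *
                               jump x.2 E (mix (S x.1) E E')) =
  \sum_i Ex P (fun E' => F i E (mix (S i) E E') * (W E - W (mix (S i) E E'))).
Proof.
rewrite -(pair_big_dep xpredT (fun i j => meets (S i) (S j))
  (fun i j => Ex P (fun E' => F i E (mix (S i) E E') * jump j E (mix (S i) E E')))) /=.
apply: eq_bigr => i _; rewrite -Ex_sum; apply: eq_Ex => E'.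
rewrite copy_sum_diff -mulr_sumr; congr (_ * _).
rewrite [RHS](bigID (fun j => meets (S i) (S j))) /= [X in _ + X]big1 ?addr0//.
by move=> j /jump0.
Qed.

Lemma square_sumE (u : {set D} -> R) :
  Ex P (fun E => square_sum E * u E) = 2^-1 * \sum_i Ex2 P (fun E E' =>
    jump i E (mix (S i) E E') * (W E - W (mix (S i) E E')) * u E).
Proof.
under eq_Ex => E do rewrite /square_sum (sum_pairs jump) -mulrA.
rewrite ExZ; congr (_ * _); rewrite -Ex_sum; apply: eq_Ex => E.
by rewrite mulr_suml; apply: eq_bigr => i _; rewrite ExZr.
Qed.

Lemma signed_sumE (u : {set D} -> R) :
  Ex P (fun E => signed_sum E * u E) = \sum_i Ex2 P (fun E E' =>
    `|jump i E (mix (S i) E E')| * (W E - W (mix (S i) E E')) * u E).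
Proof.
under eq_Ex => E do rewrite /signed_sum (sum_pairs (fun i E M => `|jump i E M|)).
rewrite -Ex_sum; apply: eq_Ex => E.
by rewrite mulr_suml; apply: eq_bigr => i _; rewrite ExZr.
Qed.

Lemma Ex_square_sum : Ex P square_sum = Ex P (fun E => W E ^+ 2).
Proof.
under [RHS]eq_Ex => E do rewrite expr2.
rewrite stein_identity.
have := square_sumE (fun=> 1) => h.
transitivity (Ex P (fun E => square_sum E * 1)).
  by apply: eq_Ex => E; rewrite mulr1.
rewrite h; congr (_ * _); apply: eq_bigr => i _.
by apply: eq_Ex => E; apply: eq_Ex => E'; rewrite mulr1.
Qed.

(** The summands are antisymmetric in the exchangeable pair. *)
Lemma Ex_signed_sum : Ex P signed_sum = 0.
Proof.
transitivity (Ex P (fun E => signed_sum E * 1)).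
  by apply: eq_Ex => E; rewrite mulr1.
rewrite signed_sumE big1 // => i _.
have := @Ex2_antisym i (fun E M => `|jump i E M| * (W E - W M)) (fun=> 1).
have -> : Ex2 P (fun E E' => `|jump i E (mix (S i) E E')| *
    (W E - W (mix (S i) E E')) * (1 - 1)) = 0.
  rewrite -[RHS](@Ex_cst _ _ P 0); apply: eq_Ex => E.
  rewrite -[RHS](@Ex_cst _ _ P 0); apply: eq_Ex => E'.
  by rewrite subrr mulr0.
move=> /(_ _)/esym/eqP h; have {}h := h _.
apply/eqP; move: h; rewrite mulf_eq0 pnatr_eq0 /=; apply => E M.
by rewrite jumpN normrN -opprB mulrN.
Qed.

Definition pair_const : R :=
  2 * (2 ^+ (2 * L)) ^+ 2 * local_const R (2 * L) *
  (cb L * (2 * (cb (2 * L)%N * cb (2 * L + L)%N))).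

Lemma square_sum_variance :
  Ex P (fun E => (square_sum E - Ex P (fun E => W E ^+ 2)) ^+ 2) <=
  pair_const * ((1 - p) * A * B ^+ 3).
Proof.
have b0 : 0 <= 2 * (cb (2 * L)%N * cb (2 * L + L)%N) * B ^+ 2.
  by rewrite !mulr_ge0 ?exprn_ge0.
have := variance_local_sum p01 P01 PK spT b0 depends_on_square_term square_term_le.
rewrite -Ex_square_sum /square_sum ExZ.
set m := Ex P (fun E => \sum_(j | r j) square_term j E) => h.
have e E : (2^-1 * (\sum_(x | r x) square_term x E) - 2^-1 * m) ^+ 2 =
   2^-1 ^+ 2 * (\sum_(x | r x) square_term x E - m) ^+ 2 by ring.
under eq_Ex => E do rewrite e.
rewrite ExZ; apply: le_trans (_ : _ <= 1 * _) _.
  apply: ler_wpM2r; last by rewrite expr2; lra.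
  by apply: Ex_ge0 => // E; rewrite sqr_ge0.
rewrite mul1r; apply: le_trans h _.
by apply: le_of_eq; rewrite /pair_const; ring.
Qed.

Lemma signed_sum_variance :
  Ex P (fun E => signed_sum E ^+ 2) <= pair_const * ((1 - p) * A * B ^+ 3).
Proof.
have b0 : 0 <= 2 * (cb (2 * L)%N * cb (2 * L + L)%N) * B ^+ 2.
  by rewrite !mulr_ge0 ?exprn_ge0.
have := variance_local_sum p01 P01 PK spT b0 depends_on_signed_term signed_term_le.
have -> : Ex P (fun E => \sum_(x | r x) signed_term x E) = 0 := Ex_signed_sum.
under eq_Ex => E do rewrite subr0.
move=> h; apply: le_trans h _.
by apply: le_of_eq; rewrite /pair_const; ring.
Qed.

Definition pair_overlap := overlap_sum p r T finset.set0.

Local Notation Z := pair_overlap.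

(** The even moments of the sum of the copies follow from those of the
    nonnegative sum Z, by applying the Stein identity to W^(2m+1). *)
Lemma copy_sum_moment_Z m :
  Ex P (fun E => W E ^+ (2 * m.+1)) <=
  (2 * ((2 * m).+1%:R * 2 ^+ (2 * L))) ^+ m.+1 * Ex P (fun E => Z E ^+ m.+1).
Proof.
set n2 := (2 * m)%N; pose c : R := n2.+1%:R * 2 ^+ (2 * L).
have c_gt0 : 0 < c by rewrite mulr_gt0 ?exprn_gt0 ?ltr0n.
have even E : W E ^+ n2 = (W E ^+ 2) ^+ m by rewrite -exprM.
have even_ge0 E : 0 <= W E ^+ n2 by rewrite even exprn_ge0 ?sqr_ge0.
have Z0 E : 0 <= Z E by exact: overlap_sum_ge0.
have absZ E : \sum_(x | r x) abs_term x E <= 2 ^+ (2 * L) * Z E.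
  rewrite /pair_overlap /overlap_sum mulr_sumr; apply: ler_sum => x _.
  rewrite /meets -finset.setI_eq0 finset.setI0 eqxx /=.
  exact: abs_term_le.
have step : Ex P (fun E => W E ^+ (2 * m.+1)) <= Ex P (fun E => c * (Z E * W E ^+ n2)).
  rewrite (_ : Ex P _ = Ex P (fun E => W E * W E ^+ n2.+1)); last first.
    by apply: eq_Ex => E; rewrite -exprS; congr (_ ^+ _); rewrite /n2; lia.
  rewrite stein_identity.
  pose k i E M := n2.+1%:R * (`|jump i E M| * `|W E - W M|) : R.
  have kC i E M : k i M E = k i E M by rewrite /k (jumpN i E M) normrN (distrC (W M)).
  have h i : Ex2 P (fun E E' => jump i E (mix (S i) E E') *
      (W E ^+ n2.+1 - W (mix (S i) E E') ^+ n2.+1)) <=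
      2 * Ex2 P (fun E E' => k i E (mix (S i) E E') * W E ^+ n2).
    apply: (@le_trans _ _ (Ex2 P (fun E E' => k i E (mix (S i) E E') * W E ^+ n2 +
        k i E (mix (S i) E E') * W (mix (S i) E E') ^+ n2))).
      apply: le_Ex => // E; apply: le_Ex => // E'; apply: le_trans (ler_norm _) _.
      rewrite normrM -mulrDr /k.
      have d := dist_exp_odd_le (W E) (W (mix (S i) E E')) m.
      rewrite -/n2 in d.
      apply: le_trans (ler_wpM2l (normr_ge0 _) d) _.
      by apply: le_of_eq; ring.
    rewrite (_ : Ex2 P _ = Ex2 P (fun E E' => k i E (mix (S i) E E') * W E ^+ n2) +
        Ex2 P (fun E E' => k i E (mix (S i) E E') * W (mix (S i) E E') ^+ n2)); last first.
      by rewrite -ExD; apply: eq_Ex => E; rewrite -ExD.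
    rewrite (Ex2_exchange P (S i) (fun E M => k i E M * W M ^+ n2)).
    rewrite mulr2n mulrDl mul1r lerD2l; apply: le_of_eq.
    by apply: eq_Ex => E; apply: eq_Ex => E'; rewrite kC.
  apply: (@le_trans _ _ (\sum_i Ex2 P (fun E E' => k i E (mix (S i) E E') * W E ^+ n2))).
    by rewrite mulr_sumr; apply: ler_sum => i _; have := h i; lra.
  rewrite -Ex_sum; apply: le_Ex => // E.
  under eq_bigr => i _ do rewrite ExZr.
  rewrite -mulr_suml mulrA ler_wpM2r//.
  apply: (@le_trans _ _ (n2.+1%:R * \sum_(x | r x) abs_term x E)); last first.
    by rewrite /c -mulrA ler_wpM2l.
  rewrite mulr_sumr.
  rewrite -(pair_big_dep xpredT (fun i j => meets (S i) (S j))
    (fun i j => n2.+1%:R * abs_term (i, j) E)) /=.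
  apply: ler_sum => i _; rewrite -mulr_sumr ExZ ler_wpM2l// -Ex_sum.
  apply: le_Ex => // E'; rewrite copy_sum_diff /= -mulr_sumr ler_wpM2l//.
  rewrite (bigID (fun j => meets (S i) (S j))) /= [X in _ + X]big1 ?addr0 => [|j /jump0->//].
  exact: ler_norm_sum.
(* with 2 c in place of c in mul_exp_le, half of the moment is absorbed in the
   left member *)
have split E : c * (Z E * W E ^+ n2) <=
    2^-1 * W E ^+ (2 * m.+1) + (2 * c) ^+ m * c * Z E ^+ m.+1.
  have c2 : 0 < 2 * c by rewrite mulr_gt0.
  have := mul_exp_le m (Z0 E) (sqr_ge0 (W E)) c2.
  rewrite -even -exprM => h.
  apply: le_trans (ler_wpM2l (ltW c_gt0) h) _.
  apply: le_of_eq; field.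
  by rewrite gt_eqF.
have := le_trans step (le_Ex P01 split).
rewrite ExD !ExZ exprS -/c; lra.
Qed.

Lemma copy_sum_moment m :
  Ex P (fun E => W E ^+ (2 * m.+1)) <=
  (2 * ((2 * m).+1%:R * 2 ^+ (2 * L))) ^+ m.+1 *
  overlap_const (2 * L) (fun u => 2 * (cb u * cb (u + L)%N)) m.+1 0 *
  (((1 - p) * (A * (cb L * B))) * ((1 - p) * (A * (cb L * B)) + B ^+ 2) ^+ m).
Proof.
apply: le_trans (copy_sum_moment_Z m) _; rewrite -[leRHS]mulrA.
apply: ler_wpM2l.
  by rewrite exprn_ge0// !mulr_ge0 ?exprn_ge0.
apply: (overlap_moment0 p01 P01 PK spT).
- by rewrite !mulr_ge0.
- by rewrite exprn_ge0.
- by move=> u; rewrite !mulr_ge0.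
Qed.

End ResampledCopies.

(** * Normal approximation of the standardized sum *)

Lemma one_add_exp_le (R : realFieldType) (x : R) n : 0 <= x ->
  (1 + x) ^+ n <= 2 ^+ n * (1 + x ^+ n).
Proof.
move=> x0; have [x1|/ltW x1] := leP x 1.
  apply: (@le_trans _ _ (2 ^+ n * 1)); last first.
    by rewrite ler_wpM2l ?exprn_ge0// lerDl exprn_ge0.
  by rewrite mulr1 lerXn2r ?nnegrE//; lra.
apply: (@le_trans _ _ ((2 * x) ^+ n)).
  by rewrite lerXn2r ?nnegrE//; lra.
by rewrite exprMn ler_wpM2l ?exprn_ge0// lerDr.
Qed.

Section StandardizedSum.
Variables (R : realType) (D : finType) (K : {set D}) (p : R) (P : D -> R).
Hypothesis p_ge0 : 0 <= p.
Hypothesis p_lt1 : p < 1.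
Hypothesis P01 : forall d, 0 <= P d <= 1.
Hypothesis PK : {in K, forall d, P d = p}.
Variables (I : finType) (S : I -> {set D}).
Variables (L : nat) (A B : R) (cb : nat -> R) (c0 : R).
Hypothesis spS : sparse K p predT S L A (fun u => cb u * B).
Hypothesis A_gt0 : 0 < A.
Hypothesis B_gt0 : 0 < B.
Hypothesis cb_ge0 : forall u, 0 <= cb u.
Hypothesis c0_gt0 : 0 < c0.
Implicit Types (E M : {set D}).

Local Notation W := (copy_sum p S).
Local Notation V := (Ex P (fun E => W E ^+ 2)).

Hypothesis V_ge : c0 * ((1 - p) * A * B) <= V.

Let p01 : 0 <= p <= 1. Proof. by rewrite p_ge0 ltW. Qed.
Let q_gt0 : 0 < 1 - p. Proof. by rewrite subr_gt0. Qed.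
Let qAB_gt0 : 0 < (1 - p) * A * B. Proof. by rewrite !mulr_gt0. Qed.
Let V_gt0 : 0 < V.
Proof. by apply: lt_le_trans V_ge; rewrite mulr_gt0. Qed.

Let s := Num.sqrt V.
Let s_gt0 : 0 < s. Proof. by rewrite sqrtr_gt0. Qed.
Let s_neq0 : s != 0. Proof. by rewrite gt_eqF. Qed.
Let s2 : s ^+ 2 = V. Proof. by rewrite sqr_sqrtr// ltW. Qed.

Definition std_copy_sum E : R := W E / Num.sqrt V.

Local Notation F := std_copy_sum.

(** The squared rate: for subgraph counts it equals 1 / (q Psi). *)
Definition defect_ratio : R := B / ((1 - p) * A).

Local Notation t := defect_ratio.

Lemma defect_ratio_gt0 : 0 < t.
Proof. by rewrite divr_gt0// mulr_gt0. Qed.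

Definition moment_const m : R :=
  (2 * ((2 * m).+1%:R * 2 ^+ (2 * L))) ^+ m.+1 *
  overlap_const (2 * L) (fun u => 2 * (cb u * cb (u + L)%N)) m.+1 0 *
  cb L / c0 ^+ m.+1.

Lemma moment_const_ge0 m : 0 <= moment_const m.
Proof.
have h : 0 <= overlap_const (2 * L) (fun u => 2 * (cb u * cb (u + L)%N)) m.+1 0.
  by apply: overlap_const_ge0 => u; rewrite !mulr_ge0.
apply: divr_ge0; last by rewrite exprn_ge0// ltW.
by apply: mulr_ge0 => //; apply: mulr_ge0.
Qed.

(** For m = 1 the bound is linear in the ratio t, which matters when t is
    large. *)
Lemma std_moment m :
  Ex P (fun E => F E ^+ (2 * m.+1)) <= moment_const m * (cb L + t) ^+ m.
Proof.
have := q_gt0; have := qAB_gt0; have := V_ge; set q := 1 - p => hVq qAB0 q0.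
have e E : F E ^+ (2 * m.+1) = W E ^+ (2 * m.+1) / V ^+ m.+1.
  by rewrite /std_copy_sum exprMn exprVn -/s (exprM s) s2.
under eq_Ex => E do rewrite e.
rewrite ExZr ler_pdivrMr ?exprn_gt0//.
apply: le_trans (copy_sum_moment p01 P01 PK spS (ltW A_gt0) (ltW B_gt0) cb_ge0 m) _.
rewrite -/q; set k1 := (2 * _) ^+ _; set k2 := overlap_const _ _ _ _.
have eB : B ^+ 2 = t * (q * A * B).
  by rewrite /t /defect_ratio -/q; field; rewrite !gt_eqF.
rewrite [q * (A * _)](_ : _ = cb L * (q * A * B)); last by ring.
rewrite eB -mulrDl exprMn /moment_const -/k1 -/k2.
have hV : (c0 * (q * A * B)) ^+ m.+1 <= V ^+ m.+1.
  by rewrite lerXn2r ?nnegrE ?(ltW V_gt0)// mulr_ge0 ?ltW// mulr_gt0.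
have k10 : 0 <= k1 by rewrite exprn_ge0// !mulr_ge0 ?exprn_ge0.
have k20 : 0 <= k2 by apply: overlap_const_ge0 => u; rewrite !mulr_ge0.
have t0 := defect_ratio_gt0.
have x0 : 0 <= k1 * k2 * cb L * (cb L + t) ^+ m.
  apply: mulr_ge0; first by do 2!apply: mulr_ge0 => //.
  by rewrite exprn_ge0// addr_ge0// ltW.
have c0n : c0 != 0 by rewrite gt_eqF.
apply: (@le_trans _ _ (k1 * k2 * cb L * (cb L + t) ^+ m *
  ((c0 * (q * A * B)) ^+ m.+1 / c0 ^+ m.+1))).
  apply: le_of_eq.
  have -> : (c0 * (q * A * B)) ^+ m.+1 / c0 ^+ m.+1 = (q * A * B) ^+ m.+1.
    by rewrite exprMn mulrAC mulfV ?expf_neq0// mul1r.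
  by rewrite (exprS (q * A * B)); ring.
apply: (@le_trans _ _ (k1 * k2 * cb L * (cb L + t) ^+ m *
  (V ^+ m.+1 / c0 ^+ m.+1))).
  by rewrite ler_wpM2l// ler_wpM2r// invr_ge0 exprn_ge0// ltW.
apply: le_of_eq; ring.
Qed.

(** The error of the first-order expansion of the Stein solution is controlled
    by the increments of a nondecreasing function h; multiplied by an increment
    of F they have the form treated by Ex2_antisym, which turns them into values
    of h against signed_sum. *)
Lemma stein_bound z :
  `|Ex P (fun E => (F E <= z)%R%:R) - Phi z| <=
  Ex P (fun E => stein_size z (F E) * `|1 - square_sum P S E / V|) +
  Ex P (fun E => stein_size z (F E) * `|signed_sum P S E / V|).
Proof.
pose f := stein_solution z; pose g w := w * f w.
pose f' w : R := g w + ((w <= z)%R%:R - Phi z).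
pose h w : R := g w - ((w <= z)%R%:R - Phi z).
have h_ndecr w w' : w <= w' -> h w <= h w'.
  move=> ww'; have := stein_mul_ndecr z ww'; rewrite /h /g.
  have : (w' <= z)%R%:R <= (w <= z)%R%:R :> R.
    by rewrite ler_nat; case: (leP w' z) => // w'z; rewrite (le_trans ww' w'z).
  rewrite -/f; lra.
(* f' is the derivative of f, and h is nondecreasing: the remainder at w is at
   most the increment of w f(w) plus that of the indicator *)
have taylor w w' : `|f w - f w' - (w - w') * f' w| <= (w - w') * (h w - h w').
  have i01 v : 0 <= ((v <= z)%R%:R : R) <= 1 by case: (v <= z); rewrite /= ?lexx ?ler01.
  have [ww'|/ltW w'w] := leP w w'.
    have /andP[] := stein_increment z ww'; have := h_ndecr _ _ ww'.
    have := stein_mul_ndecr z ww'; have := i01 w; have := i01 w'.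
    have : (w' <= z)%R%:R <= (w <= z)%R%:R :> R.
      by rewrite ler_nat; case: (leP w' z) => // w'z; rewrite (le_trans ww' w'z).
    rewrite /h /f' /g -/f ler_norml.
    set i := (w <= z)%R%:R; set i' := (w' <= z)%R%:R => *.
    apply/andP; split; nra.
  have /andP[] := stein_increment z w'w; have := h_ndecr _ _ w'w.
  have := stein_mul_ndecr z w'w; have := i01 w; have := i01 w'.
  have : (w <= z)%R%:R <= (w' <= z)%R%:R :> R.
    by rewrite ler_nat; case: (leP w z) => // wz; rewrite (le_trans w'w wz).
  rewrite /h /f' /g -/f ler_norml.
  set i := (w <= z)%R%:R; set i' := (w' <= z)%R%:R => *.
  apply/andP; split; nra.
have FB E M : F E - F M = (W E - W M) / s by rewrite /std_copy_sum -/s; ring.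
pose rem E M := f (F E) - f (F M) - (F E - F M) * f' (F E).
have remE : Ex P (fun E => F E * f (F E)) - Ex P (fun E => f' (F E) * (square_sum P S E / V)) =
    s^-1 * (2^-1 * \sum_i Ex2 P (fun E E' =>
      jump R S i E (mix (S i) E E') * rem E (mix (S i) E E'))).
  have -> : Ex P (fun E => F E * f (F E)) = s^-1 * Ex P (fun E => W E * f (F E)).
    by rewrite -ExZ; apply: eq_Ex => E; rewrite /std_copy_sum -/s; ring.
  rewrite (stein_identity PK spS (fun E => f (F E))).
  have -> : Ex P (fun E => f' (F E) * (square_sum P S E / V)) =
      s^-1 * (Ex P (fun E => square_sum P S E * (s^-1 * f' (F E)))).
    rewrite -ExZ; apply: eq_Ex => E; rewrite -s2; field; exact: s_neq0.
  rewrite (square_sumE p P S) -mulrBr; congr (_ * _).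
  rewrite -mulrBr; congr (_ * _); rewrite -sumrB; apply: eq_bigr => i _.
  rewrite /Ex2 -ExB; apply: eq_Ex => E; rewrite -ExB; apply: eq_Ex => E'.
  by rewrite /rem FB; ring.
have remB : `|s^-1 * (2^-1 * \sum_i Ex2 P (fun E E' =>
      jump R S i E (mix (S i) E E') * rem E (mix (S i) E E')))| <=
    Ex P (fun E => stein_size z (F E) * `|signed_sum P S E / V|).
  apply: (@le_trans _ _ (s^-1 * (2^-1 * \sum_i Ex2 P (fun E E' =>
      `|jump R S i E (mix (S i) E E')| * (F E - F (mix (S i) E E')) *
      (h (F E) - h (F (mix (S i) E E'))))))).
    rewrite normrM [`|s^-1|]gtr0_norm ?invr_gt0// ler_wpM2l ?invr_ge0 ?(ltW s_gt0)//.
    rewrite normrM [`|2^-1|]gtr0_norm ?invr_gt0// ler_wpM2l ?invr_ge0//.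
    apply: le_trans (ler_norm_sum _ _ _) _; apply: ler_sum => i _.
    apply: le_trans (ler_norm_Ex P01 _) _; apply: le_Ex => // E.
    apply: le_trans (ler_norm_Ex P01 _) _; apply: le_Ex => // E'.
    by rewrite normrM -mulrA ler_wpM2l//; exact: taylor.
  have -> : s^-1 * (2^-1 * \sum_i Ex2 P (fun E E' =>
      `|jump R S i E (mix (S i) E E')| * (F E - F (mix (S i) E E')) *
      (h (F E) - h (F (mix (S i) E E'))))) =
      Ex P (fun E => h (F E) * (signed_sum P S E / V)).
    have -> : Ex P (fun E => h (F E) * (signed_sum P S E / V)) =
        s^-1 * Ex P (fun E => signed_sum P S E * (s^-1 * h (F E))).
      rewrite -ExZ; apply: eq_Ex => E; rewrite -s2; field; exact: s_neq0.
    rewrite (signed_sumE p P S); congr (_ * _); rewrite mulr_sumr; apply: eq_bigr => i _.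
    rewrite (@Ex2_antisym _ _ _ _ S i (fun E M => `|jump R S i E M| * (F E - F M)) (fun E => h (F E))).
      rewrite mulrA mulVf ?mul1r ?pnatr_eq0//; apply: eq_Ex => E; apply: eq_Ex => E'.
      by rewrite FB; ring.
    by move=> E M; rewrite /jump -normrN opprB; ring.
  apply: le_trans (ler_norm _) _; apply: le_trans (ler_norm_Ex P01 _) _.
  apply: le_Ex => // E; rewrite normrM ler_wpM2r//.
  by apply: le_trans (ler_normB _ _) _.
have -> : Ex P (fun E => (F E <= z)%R%:R) - Phi z =
    Ex P (fun E => f' (F E) * (1 - square_sum P S E / V)) -
    (Ex P (fun E => F E * f (F E)) - Ex P (fun E => f' (F E) * (square_sum P S E / V))).
  rewrite -[X in _ - X = _](@Ex_cst _ _ P) -!ExB; apply: eq_Ex => E.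
  by rewrite /f' /g; ring.
apply: le_trans (ler_normB _ _) _; apply: lerD; last by rewrite remE.
apply: le_trans (ler_norm_Ex P01 _) _; apply: le_Ex => // E.
by rewrite normrM ler_wpM2r//; exact: ler_normD.
Qed.

Definition deviation_const : R := pair_const L cb / c0 ^+ 2.

Lemma pair_const_ge0 : 0 <= pair_const L cb.
Proof.
by apply: mulr_ge0; rewrite ?mulr_ge0 ?sqr_ge0 ?exprn_ge0 ?local_const_ge0.
Qed.

Let scaled_variance (x : R) :
  x <= pair_const L cb * ((1 - p) * A * B ^+ 3) -> x / V ^+ 2 <= deviation_const * t.
Proof.
move=> hx; rewrite ler_pdivrMr ?exprn_gt0//; apply: le_trans hx _.
have c0n : c0 != 0 by rewrite gt_eqF.
have qn : 1 - p != 0 by rewrite gt_eqF.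
have An : A != 0 by rewrite gt_eqF.
apply: (@le_trans _ _ (deviation_const * t * (c0 * ((1 - p) * A * B)) ^+ 2)).
  apply: le_of_eq.
  by rewrite /deviation_const /defect_ratio; field; rewrite qn An c0n.
apply: ler_wpM2l.
  apply: mulr_ge0; last exact/ltW/defect_ratio_gt0.
  by rewrite divr_ge0 ?pair_const_ge0// exprn_ge0// ltW.
by rewrite lerXn2r ?nnegrE ?(ltW V_gt0)// mulr_ge0 ?ltW.
Qed.

Lemma square_sum_deviation :
  Ex P (fun E => (1 - square_sum P S E / V) ^+ 2) <= deviation_const * t.
Proof.
have h := square_sum_variance p01 P01 PK spS (ltW B_gt0) cb_ge0.
apply: le_trans (scaled_variance h); rewrite -ExZr.
apply: le_of_eq; apply: eq_Ex => E; field; by rewrite gt_eqF.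
Qed.

Lemma signed_sum_deviation :
  Ex P (fun E => (signed_sum P S E / V) ^+ 2) <= deviation_const * t.
Proof.
have h := signed_sum_variance p01 P01 PK spS (ltW B_gt0) cb_ge0.
apply: le_trans (scaled_variance h); rewrite -ExZr.
by apply: le_of_eq; apply: eq_Ex => E; rewrite expr_div_n.
Qed.

(** Cauchy--Schwarz, through the inequality u v <= (w u^2 + v^2 / w) / 2 with
    the optimal weight w = y x. *)
Lemma Ex_mul_norm_le (f g : {set D} -> R) (a b x y : R) : 0 < x -> 0 < y ->
  Ex P (fun E => f E ^+ 2) <= a / y ^+ 2 -> Ex P (fun E => g E ^+ 2) <= b * x ^+ 2 ->
  Ex P (fun E => f E * `|g E|) <= 2^-1 * (a + b) / y * x.
Proof.
move=> x0 y0 ha hb.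
have xn : x != 0 by rewrite gt_eqF.
have yn : y != 0 by rewrite gt_eqF.
apply: (@le_trans _ _ (Ex P (fun E => 2^-1 * (y * x) * f E ^+ 2 + 2^-1 / (y * x) * g E ^+ 2))).
  apply: le_Ex => // E; rewrite -[g E ^+ 2]real_normK ?num_real//.
  have := sqr_ge0 ((y * x) * f E - `|g E|).
  have yx0 : 0 < y * x by rewrite mulr_gt0.
  set w := y * x in yx0 *; set u := `|g E| => h.
  rewrite -subr_ge0 [X in 0 <= X](_ : _ = (w * f E - u) ^+ 2 / (2 * w)).
    by rewrite divr_ge0// mulr_ge0// ltW.
  by field; rewrite gt_eqF.
rewrite ExD !ExZ.
apply: (@le_trans _ _ (2^-1 * (y * x) * (a / y ^+ 2) + 2^-1 / (y * x) * (b * x ^+ 2))).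
  apply: lerD; apply: ler_wpM2l => //.
    by rewrite !mulr_ge0 ?invr_ge0 ?ltW.
  by rewrite divr_ge0 ?mulr_ge0 ?invr_ge0 ?ltW.
apply: le_of_eq; field; by rewrite xn yn.
Qed.

(** stein_size is small unless |F| > |z| / 2, an event that the moment of order
    2 k makes unlikely. *)
Lemma stein_bound_moment (k : nat) (Ck mk z : R) :
  (forall w, `|w| <= `|z| / 2 -> stein_size z w <= Ck / (1 + `|z|) ^+ k) ->
  Ex P (fun E => F E ^+ (2 * k)) <= mk ->
  `|Ex P (fun E => (F E <= z)%R%:R) - Phi z| <=
  (Ck ^+ 2 + 4 * (2 ^+ (2 * k) * (1 + 2 ^+ (2 * k) * mk)) + deviation_const) /
    (1 + `|z|) ^+ k * Num.sqrt t.
Proof.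
move=> hC hm; set y := (1 + `|z|) ^+ k.
have z1 : 0 < 1 + `|z| by rewrite ltr_pwDl.
have y0 : 0 < y by rewrite exprn_gt0.
have t0 := defect_ratio_gt0.
have st0 : 0 < Num.sqrt t by rewrite sqrtr_gt0.
have st2 : Num.sqrt t ^+ 2 = t by rewrite sqr_sqrtr// ltW.
set a := Ck ^+ 2 + _.
have hG : Ex P (fun E => stein_size z (F E) ^+ 2) <= a / y ^+ 2.
  apply: (@le_trans _ _ (Ex P (fun E =>
      (Ck ^+ 2 + 4 * (2 ^+ (2 * k) * (1 + 2 ^+ (2 * k) * F E ^+ (2 * k)))) / y ^+ 2))).
    apply: le_Ex => // E; move: (F E) => w; rewrite ler_pdivlMr ?exprn_gt0// -exprMn.
    have e0 : 0 <= w ^+ (2 * k) by rewrite exprM exprn_ge0 ?sqr_ge0.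
    have p2 : 0 <= 2 ^+ (2 * k) :> R by rewrite exprn_ge0.
    have G0 := stein_size_ge0 z (w).
    have [wz|zw] := leP `|w| (`|z| / 2).
      have Gy : stein_size z (w) * y <= Ck by rewrite -ler_pdivlMr// hC.
      have Gy0 : 0 <= stein_size z (w) * y by rewrite mulr_ge0// ltW.
      apply: (@le_trans _ _ (Ck ^+ 2)); last by rewrite lerDl !mulr_ge0// addr_ge0 ?mulr_ge0.
      by rewrite lerXn2r ?nnegrE// (le_trans Gy0).
    apply: (@le_trans _ _ (4 * (2 ^+ (2 * k) * (1 + 2 ^+ (2 * k) * w ^+ (2 * k))))); last first.
      by rewrite lerDr sqr_ge0.
    rewrite exprMn (_ : 4 = 2 ^+ 2); last by ring.
    apply: ler_pM; rewrite ?sqr_ge0//.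
      by rewrite lerXn2r ?nnegrE// stein_size_le2.
    rewrite /y -exprM mulnC.
    have -> : 2 ^+ (2 * k) * w ^+ (2 * k) = (2 * `|w|) ^+ (2 * k) :> R.
      by rewrite exprMn [`|w| ^+ _]exprM real_normK ?num_real// -exprM.
    apply: (@le_trans _ _ ((1 + 2 * `|w|) ^+ (2 * k))).
      by rewrite lerXn2r ?nnegrE ?(ltW z1)// ?addr_ge0 ?mulr_ge0//; lra.
    by apply: one_add_exp_le; rewrite mulr_ge0.
  rewrite ExZr ler_wpM2r ?invr_ge0 ?sqr_ge0//.
  rewrite ExD Ex_cst lerD2l ExZ ler_wpM2l// ExZ ler_wpM2l ?exprn_ge0//.
  by rewrite ExD Ex_cst lerD2l ExZ ler_wpM2l ?exprn_ge0.
apply: le_trans (stein_bound z) _.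
have b1 := @Ex_mul_norm_le (fun E => stein_size z (F E))
  (fun E => 1 - square_sum P S E / V) a deviation_const _ _ st0 y0 hG.
have b2 := @Ex_mul_norm_le (fun E => stein_size z (F E))
  (fun E => signed_sum P S E / V) a deviation_const _ _ st0 y0 hG.
rewrite st2 in b1 b2.
have := lerD (b1 square_sum_deviation) (b2 signed_sum_deviation).
move=> h; apply: le_trans h _; apply: le_of_eq.
by field; rewrite gt_eqF.
Qed.

(** If the squared rate t is at least 1, no normal approximation takes place
    and Markov's inequality is enough: the third moment is at most the mean of
    sqrt t F^2 and F^4 / sqrt t, of order sqrt t. *)
Lemma third_moment_bound (C3 z : R) : 1 <= t ->
  (forall w, `|w| <= `|z| / 2 -> `|(w <= z)%R%:R - Phi z| <= C3 / (1 + `|z|) ^+ 3) ->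
  `|Ex P (fun E => (F E <= z)%R%:R) - Phi z| <=
  (C3 + 8 + 32 + 32 * (moment_const 1 * (cb L + 1))) / (1 + `|z|) ^+ 3 * Num.sqrt t.
Proof.
move=> t1 hC.
have z1 : 0 < 1 + `|z| by rewrite ltr_pwDl.
set y := (1 + `|z|) ^+ 3 in hC *; have y0 : 0 < y by rewrite exprn_gt0.
have t0 := defect_ratio_gt0.
have st0 : 0 < Num.sqrt t by rewrite sqrtr_gt0.
have st2 : Num.sqrt t ^+ 2 = t by rewrite sqr_sqrtr// ltW.
have st1 : 1 <= Num.sqrt t by have := ler_wsqrtr t1; rewrite sqrtr1.
have C30 : 0 <= C3.
  have /hC : `|0 : R| <= `|z| / 2 by rewrite normr0 divr_ge0.
  rewrite ler_pdivlMr//; apply: le_trans; exact: mulr_ge0 (normr_ge0 _) (ltW y0).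
have F2 : Ex P (fun E => F E ^+ 2) = 1.
  rewrite (_ : Ex P _ = Ex P (fun E => W E ^+ 2 / V)).
    by rewrite ExZr divff// gt_eqF.
  by apply: eq_Ex => E; rewrite /std_copy_sum expr_div_n s2.
have F4 : Ex P (fun E => F E ^+ 4) <= moment_const 1 * (cb L + 1) * t.
  apply: le_trans (std_moment 1) _; rewrite expr1 -mulrA ler_wpM2l ?moment_const_ge0//.
  rewrite mulrDl mul1r lerD2r; have := cb_ge0 L; nra.
have dist : `|Ex P (fun E => (F E <= z)%R%:R) - Phi z| <=
    Ex P (fun E => `|(F E <= z)%R%:R - Phi z|).
  by rewrite -[X in _ - X](@Ex_cst _ _ P) -ExB; exact: ler_norm_Ex.
apply: le_trans dist _.
set x := Num.sqrt t in st0 st2 st1 *.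
apply: (@le_trans _ _ (Ex P (fun E =>
    (C3 + 8 + 32 * x * F E ^+ 2 + 32 / x * F E ^+ 4) / y))).
  apply: le_Ex => // E; move: (F E) => w; rewrite ler_pdivlMr//.
  have w4 : w ^+ 4 = (w ^+ 2) ^+ 2 by ring.
  have r0 : 0 <= 32 * x * w ^+ 2 + 32 / x * w ^+ 4.
    have : 0 <= x * w ^+ 2 by rewrite mulr_ge0 ?sqr_ge0// ltW.
    have : 0 <= w ^+ 4 / x by rewrite w4 divr_ge0 ?sqr_ge0// ltW.
    lra.
  have [wz|zw] := leP `|w| (`|z| / 2).
    by have := hC _ wz; rewrite ler_pdivlMr//; lra.
  have h1 := Phi_dist_le1 z (w).
  apply: (@le_trans _ _ (1 * y)); first by rewrite ler_wpM2r// ltW.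
  rewrite mul1r; apply: (@le_trans _ _ ((1 + 2 * `|w|) ^+ 3)).
    by rewrite lerXn2r ?nnegrE ?(ltW z1)// ?addr_ge0 ?mulr_ge0//; lra.
  apply: le_trans (one_add_exp_le _ _) _; first by rewrite mulr_ge0.
  have -> : w ^+ 4 = `|w| ^+ 4 by rewrite w4 -[w ^+ 2]real_normK ?num_real//; ring.
  rewrite -[w ^+ 2]real_normK ?num_real//.
  set u := `|w|.
  have : 0 <= (x * u - u ^+ 2) ^+ 2 / x by rewrite divr_ge0 ?sqr_ge0 ?ltW.
  have -> : (x * u - u ^+ 2) ^+ 2 / x = x * u ^+ 2 - 2 * u ^+ 3 + u ^+ 4 / x.
    by field; rewrite gt_eqF.
  by lra.
rewrite ExZr !ExD !Ex_cst !ExZ F2 [leRHS]mulrAC ler_wpM2r ?invr_ge0 ?(ltW y0)//.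
have : 32 / x * Ex P (fun E => F E ^+ 4) <= 32 / x * (moment_const 1 * (cb L + 1) * t).
  by rewrite ler_wpM2l// divr_ge0// ltW.
have -> : 32 / x * (moment_const 1 * (cb L + 1) * t) = 32 * (moment_const 1 * (cb L + 1)) * x.
  by rewrite -st2; field; rewrite gt_eqF.
nra.
Qed.

End StandardizedSum.

(** * Copies of a graph in the complete graph *)

Section Copies.
Variables (V : finType) (G0 : graph V).
Hypothesis simpleG0 : simple_graph G0.
Hypothesis edgeG0 : (1 <= #|edges G0|)%N.

Local Notation V0 := (vertices G0).
Local Notation E0 := (edges G0).

Lemma simple_card (T : finType) (G : graph T) (e : {set T}) : simple_graph G ->
  e \in edges G -> #|e| = 2%N.
Proof. by move=> /forallP/(_ e)/implyP h /h /andP[/eqP]. Qed.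

Lemma simple_sub (T : finType) (G : graph T) (e : {set T}) : simple_graph G ->
  e \in edges G -> e \subset vertices G.
Proof. by move=> /forallP/(_ e)/implyP h /h /andP[]. Qed.

Lemma exists_vertex : exists x, x \in V0.
Proof.
have /card_gt0P[e eE] := edgeG0.
have /cards2P[x [y [_ exy]]] : #|e| == 2%N by rewrite (simple_card simpleG0 eE).
exists x; apply: (fintype.subsetP (simple_sub simpleG0 eE)).
by rewrite exy !inE eqxx.
Qed.

Variable m : nat.
Local Notation n := m.+1.
Implicit Types (f g : {ffun V -> 'I_n}) (H : graph 'I_n).

Definition copies : {set graph 'I_n} :=
  [set H : graph 'I_n | simple_graph H && isomorphic H G0].

(** The maps on X, extended by ord0 so that each of them is counted once. *)
Definition placements (X : {set V}) : {pred {ffun V -> 'I_n}} :=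
  pffun_on ord0 (mem X) predT.

Lemma placementsP (X : {set V}) f :
  reflect (forall x, x \notin X -> f x = ord0) (f \in placements X).
Proof.
apply: (iffP idP) => [/pffun_onP[h _] x xX|h].
  apply/eqP/negPn/negP => fx; move: xX; rewrite (fintype.subsetP h) //.
apply/pffun_onP; split => [|y _ //].
by apply/fintype.subsetP => x fx; apply/negPn/negP => /h fx0; rewrite inE fx0 eqxx in fx.
Qed.

Lemma card_placements (X : {set V}) : #|placements X| = (n ^ #|X|)%N.
Proof. by rewrite card_pffun_on card_ord. Qed.

Definition graph_image f : graph 'I_n :=
  (f @: V0, [set f @: (e : {set V}) | e in E0]).

Definition embedding f : bool := (f \in placements V0) && dinjectiveb f (mem V0).

Lemma embedding_inj f : embedding f -> {in V0 &, injective f}.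
Proof. by case/andP => _ /dinjectiveP. Qed.

Lemma left_inverse_on (A B : finType) (a0 : A) (X : {set A}) (g : A -> B) :
  {in X &, injective g} -> exists k : B -> A, {in X, cancel g k}.
Proof.
move=> gI; exists (fun y => odflt a0 [pick x in X | g x == y]) => x xX /=.
case: pickP => [x' /andP[x'X /eqP gx]|/(_ x)]; last by rewrite /= xX eqxx.
exact: gI.
Qed.

Lemma imset_inj_on (A B : finType) (X : {set A}) (g : A -> B) :
  {in X &, injective g} ->
  forall Y Z : {set A}, Y \subset X -> Z \subset X -> g @: Y = g @: Z -> Y = Z.
Proof.
move=> gI Y Z /fintype.subsetP YX /fintype.subsetP ZX YZ.
apply/setP => x; apply/idP/idP => xY.
  have : g x \in g @: Z by rewrite -YZ imset_f.
  by case/imsetP => z zZ gxz; rewrite (gI x z (YX _ xY) (ZX _ zZ) gxz).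
have : g x \in g @: Y by rewrite YZ imset_f.
by case/imsetP => z zZ gxz; rewrite (gI x z (ZX _ xY) (YX _ zZ) gxz).
Qed.

Lemma imset_set2 (A B : finType) (g : A -> B) (x y : A) :
  g @: [set x; y] = [set g x; g y].
Proof. by rewrite imsetU1 imset_set1. Qed.

Lemma imset_edges_inj f : {in V0 &, injective f} ->
  {in E0 &, injective (fun e : {set V} => f @: e)}.
Proof.
move=> fI e e' eE e'E; apply: (imset_inj_on fI); exact: simple_sub simpleG0 _.
Qed.

Lemma graph_image_copy f : embedding f -> graph_image f \in copies.
Proof.
move=> /embedding_inj fI; rewrite inE; apply/andP; split.
  apply/forall_inP => _ /imsetP[e eE ->]; have es := simple_sub simpleG0 eE.
  rewrite card_in_imset ?(simple_card simpleG0 eE) ?eqxx ?imsetS//.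
  by apply: sub_in2 fI; exact: fintype.subsetP es.
have [x0 _] := exists_vertex.
have [k kK] := left_inverse_on x0 fI.
apply/existsP; exists [ffun y => k y]; apply/and3P; split.
- apply/dinjectiveP => _ _ /imsetP[x xV ->] /imsetP[y yV ->].
  by rewrite !ffunE !kK // => ->.
- apply/eqP/setP => x; apply/imsetP/idP => [[_ /imsetP[y yV ->] ->]|xV].
    by rewrite ffunE kK.
  by exists (f x); rewrite ?ffunE ?kK ?imset_f.
apply/forall_inP => _ /imsetP[x xV ->]; apply/forall_inP => _ /imsetP[y yV ->].
rewrite !ffunE !kK // -imset_set2; apply/eqP; apply/imsetP/idP => [[e eE fe]|xyE].
  suff -> : [set x; y] = e by [].
  apply: (imset_inj_on fI) => //; last exact: simple_sub simpleG0 _.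
  by apply/fintype.subsetP => w; rewrite !inE => /orP[]/eqP->.
by exists [set x; y].
Qed.

(** The isomorphism goes from the copy to G0, so the embedding is its
    inverse. *)
Lemma copy_placement H : H \in copies ->
  exists2 f, embedding f & graph_image f = H.
Proof.
rewrite inE => /andP[simpleH /existsP[h /and3P[/dinjectiveP hI /eqP hV /forall_inP hE]]].
have [k kK] := left_inverse_on ord0 hI.
have kV x : x \in V0 -> k x \in vertices H /\ h (k x) = x.
  by rewrite -hV => /imsetP[y yH ->]; rewrite kK.
pose f : {ffun V -> 'I_n} := [ffun x => if x \in V0 then k x else ord0].
have fk x : x \in V0 -> f x = k x by move=> xV; rewrite ffunE xV.
have fI : {in V0 &, injective f}.
  by move=> x y xV yV; rewrite !fk // => kxy; rewrite -(kV x xV).2 kxy (kV y yV).2.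
exists f.
  apply/andP; split; last exact/dinjectiveP.
  by apply/placementsP => x /negbTE xV; rewrite ffunE xV.
have hV0 y : y \in vertices H -> h y \in V0 by move=> yH; rewrite -hV imset_f.
have fh y : y \in vertices H -> f (h y) = y.
  by move=> yH; rewrite fk ?hV0// kK.
rewrite [RHS](surjective_pairing H); congr pair.
  apply/setP => y; apply/imsetP/idP => [[x xV ->]|yH].
    by rewrite fk //; have [] := kV x xV.
  by exists (h y); rewrite ?fh ?hV0.
apply/setP => d; apply/imsetP/idP => [[e eE ->]|dE].
  have /cards2P[x [y [_ exy]]] : #|e| == 2%N by rewrite (simple_card simpleG0 eE).
  have /fintype.subsetP es := simple_sub simpleG0 eE.
  have xV : x \in V0 by rewrite es // exy !inE eqxx.
  have yV : y \in V0 by rewrite es // exy !inE eqxx orbT.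
  have [xH hx] := kV x xV; have [yH hy] := kV y yV.
  have /forall_inP/(_ _ yH)/eqP := hE _ xH.
  by rewrite hx hy -exy eE exy imset_set2 !fk.
have /cards2P[x [y [_ exy]]] : #|d| == 2%N by rewrite (simple_card simpleH dE).
have /fintype.subsetP es := simple_sub simpleH dE.
have xH : x \in vertices H by rewrite es // exy !inE eqxx.
have yH : y \in vertices H by rewrite es // exy !inE eqxx orbT.
have /forall_inP/(_ _ yH)/eqP := hE _ xH.
rewrite -exy [_ \in edges H]dE => hxy.
by exists [set h x; h y]; rewrite -?hxy // imset_set2 !fh.
Qed.

Lemma card_copy_edges H : H \in copies -> #|edges H| = #|E0|.
Proof.
by move=> /copy_placement[f /embedding_inj fI <-]; rewrite card_in_imset //; exact: imset_edges_inj.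
Qed.

Lemma card_copy_vertices H : H \in copies -> #|vertices H| = #|V0|.
Proof. by move=> /copy_placement[f /embedding_inj fI <-]; rewrite card_in_imset. Qed.

Lemma copy_edges_complete H : H \in copies -> edges H \subset complete_edges n.
Proof.
rewrite inE => /andP[sH _]; apply/fintype.subsetP => d dE.
by rewrite inE (simple_card sH dE).
Qed.

Lemma card_cover_le (T : finType) (U : {set {set T}}) (u : nat) :
  {in U, forall d : {set T}, #|d| = 2%N} -> (#|U| <= u)%N -> (#|finset.cover U| <= 2 * u)%N.
Proof.
move=> U2 Uu; apply: leq_trans (leq_card_cover U) _.
by rewrite (eq_bigr (fun=> 2%N)) // sum_nat_const mulnC leq_mul2l.
Qed.

(** A placement that sends the edges of J into U sends the vertices of J into
    the vertices of U; the other vertices of G0 are free. *)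
Lemma card_placements_into (J : {set {set V}}) (U : {set {set 'I_n}}) (u : nat) :
  J \subset E0 -> {in U, forall d : {set 'I_n}, #|d| = 2%N} -> (#|U| <= u)%N ->
  (#|[set f in placements V0 | [forall e in J, f @: (e : {set V}) \in U]]| <=
   (2 * u) ^ #|finset.cover J| * n ^ (#|V0| - #|finset.cover J|))%N.
Proof.
move=> JE U2 Uu.
have covV : finset.cover J \subset V0.
  apply/fintype.subsetP => x /finset.bigcupP[e eJ].
  by apply: (fintype.subsetP (simple_sub simpleG0 (fintype.subsetP JE e eJ))).
pose Fx (x : V) : pred 'I_n :=
  fun y => if x \in finset.cover J then y \in finset.cover U else (x \in V0) || (y == ord0).
apply: (@leq_trans #|family Fx|).
  apply: subset_leq_card; apply/fintype.subsetP => f; rewrite inE => /andP[fV /forall_inP fJ].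
  apply/familyP => x; rewrite unfold_in /Fx; case: ifP => [/finset.bigcupP[e eJ xe]|_].
    by apply/finset.bigcupP; exists (f @: e); [exact: fJ|exact: imset_f].
  have [//|xV] := boolP (x \in V0); rewrite /=; apply/eqP.
  exact: (placementsP _ _ fV).
rewrite card_family foldrE big_map big_enum /= (eq_bigl predT) //.
rewrite (bigID (mem (finset.cover J))) /= (bigID (mem V0) (fun x => x \notin _)) /=.
rewrite [X in (X * _)%N](eq_bigr (fun=> #|finset.cover U|)) => [|x xJ]; last first.
  by apply: eq_card => y; rewrite [LHS]unfold_in /Fx xJ.
rewrite [X in (_ * (X * _))%N](eq_bigr (fun=> n)) => [|x /andP[/negbTE xJ xV]]; last first.
  by rewrite -[RHS](card_ord n); apply: eq_card => y; rewrite [LHS]unfold_in /Fx xJ xV.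
rewrite [X in (_ * (_ * X))%N]big1 => [|x /andP[/negbTE xJ /negbTE xV]]; last first.
  by rewrite -[RHS](card1 (ord0 : 'I_n)); apply: eq_card => y; rewrite [LHS]unfold_in /Fx xJ xV.
rewrite muln1 !prod_nat_const; apply: leq_mul.
  by elim: #|_ : {pred V}| => // k IH; rewrite !expnS leq_mul ?card_cover_le.
rewrite leq_eqVlt; apply/orP; left; apply/eqP; congr (_ ^ _)%N.
rewrite -(cardsID (finset.cover J) V0) (finset.setIidPr covV) addKn.
by apply: eq_card => x; rewrite !inE.
Qed.

End Copies.

(** * Weights and correlations of the copies *)

(** Cauchy--Schwarz, from the nonnegativity of the empirical variance. *)
Lemma sqr_sum_le (R : realFieldType) (T : finType) (A : {pred T}) (N : T -> R) :
  (\sum_(r in A) N r) ^+ 2 <= #|A|%:R * \sum_(r in A) N r ^+ 2.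
Proof.
have [A0|A0] := posnP #|A|.
  by rewrite A0 mul0r big_pred0 ?expr0n//; move/card0_eq: A0.
set s := \sum_(_ in A) N _; set s2 := \sum_(_ in A) N _ ^+ 2.
have c0 : 0 < #|A|%:R :> R by rewrite ltr0n.
pose mean : R := s / #|A|%:R.
have : 0 <= \sum_(r in A) (N r - mean) ^+ 2 by apply: sumr_ge0 => r _; exact: sqr_ge0.
have -> : \sum_(r in A) (N r - mean) ^+ 2 = s2 - s ^+ 2 / #|A|%:R.
  rewrite (eq_bigr (fun r => N r ^+ 2 - 2 * mean * N r + mean ^+ 2)) => [|r _]; last by ring.
  rewrite big_split sumrB /= -mulr_sumr sumr_const -/s -/s2 -mulr_natl /mean.
  by field; rewrite gt_eqF.
by rewrite subr_ge0 ler_pdivrMr// mulrC.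
Qed.

Lemma ffact_ge n v : (v <= n)%N -> (n ^ v <= n ^_ v * v ^ v)%N.
Proof.
move=> vn; rewrite ffact_prod -[X in (v ^ X)%N](card_ord v) -prod_nat_const -big_split /=.
rewrite -[X in (n ^ X)%N](card_ord v) -prod_nat_const; apply: leq_prod => i _.
have iv := ltn_ord i; nia.
Qed.

Lemma expr_double_sub (F : fieldType) (x : F) a b : x != 0 -> (b <= a)%N ->
  x ^+ (2 * a - b) = x ^+ a * x ^+ a / x ^+ b.
Proof.
move=> x0 ba; apply: (canRL (mulfK _)); first by rewrite expf_neq0.
by rewrite -!exprD; congr (_ ^+ _); lia.
Qed.

Section CopiesInTheRandomGraph.
Variables (R : realType) (V : finType) (G0 : graph V).
Hypothesis simpleG0 : simple_graph G0.
Hypothesis edgeG0 : (1 <= #|edges G0|)%N.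
Variables (m : nat) (p : R).
Hypothesis p_gt0 : 0 < p.
Hypothesis p_le1 : p <= 1.

Local Notation n := m.+1.
Local Notation V0 := (vertices G0).
Local Notation E0 := (edges G0).
Local Notation v := #|vertices G0|.
Local Notation e0 := #|edges G0|.
Local Notation psi := (Psi G0 n p).

Let p_ge0 : 0 <= p. Proof. exact: ltW. Qed.
Let n_gt0 : 0 < n%:R :> R. Proof. by rewrite ltr0n. Qed.

Lemma Psi_le (H : graph V) : subgraph H G0 -> (1 <= #|edges H|)%N ->
  psi <= n%:R ^+ #|vertices H| * p ^+ #|edges H|.
Proof. by move=> HG H1; apply: bigmin_le_cond; rewrite HG. Qed.

Lemma subgraph_refl : subgraph G0 G0.
Proof. by rewrite /subgraph simpleG0 !fintype.subxx. Qed.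

Lemma Psi_attained : exists2 H : graph V,
  subgraph H G0 && (1 <= #|edges H|)%N &
  psi = n%:R ^+ #|vertices H| * p ^+ #|edges H|.
Proof.
rewrite /Psi; elim/big_ind: _ => [|x y hx hy|H hH].
- by exists G0; rewrite ?subgraph_refl.
- by rewrite minEle; case: ifP.
- by exists H.
Qed.

Lemma Psi_gt0 : 0 < psi.
Proof. by have [H _ ->] := Psi_attained; rewrite mulr_gt0// exprn_gt0. Qed.

Definition copy_type := {H : graph 'I_n | H \in copies G0 m}.
Definition copy_edges (i : copy_type) : {set {set 'I_n}} := edges (val i).

Local Notation S := copy_edges.
Local Notation K := (complete_edges n).
Local Notation A := (n%:R ^+ v * p ^+ e0 : R).

Lemma copy_edges_sub i : S i \subset K.
Proof. by apply: (copy_edges_complete (G0 := G0)); exact: valP. Qed.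

Lemma card_copy_edgesE i : #|S i| = e0.
Proof. by apply: (card_copy_edges simpleG0); exact: valP. Qed.

Lemma sum_copies_le (w : {set {set 'I_n}} -> R) : (forall X, 0 <= w X) ->
  \sum_i w (S i) <= \sum_(f | embedding G0 f) w (edges (graph_image G0 f)).
Proof.
move=> w0.
have fP (i : copy_type) : exists f, embedding G0 f && (graph_image G0 f == val i).
  have [f fE fi] := copy_placement simpleG0 (valP i).
  by exists f; rewrite fE fi eqxx.
pose f_of i := xchoose (fP i).
have f_ofP i : embedding G0 (f_of i) /\ graph_image G0 (f_of i) = val i.
  by have /andP[? /eqP ?] := xchooseP (fP i).
have f_inj : {in [set: copy_type] &, injective f_of}.
  move=> i j _ _ ij; apply: val_inj.
  by rewrite -(f_ofP i).2 ij (f_ofP j).2.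
rewrite (eq_bigr (fun i => w (edges (graph_image G0 (f_of i))))); last first.
  by move=> i _; rewrite (f_ofP i).2.
rewrite [leRHS](bigID (mem (f_of @: [set: copy_type]))) /= -[leLHS]addr0.
apply: lerD; last by apply: sumr_ge0.
apply: le_of_eq.
transitivity (\sum_(i in [set: copy_type]) w (edges (graph_image G0 (f_of i)))).
  by apply: eq_bigl => i; rewrite inE.
rewrite -(big_imset (fun f => w (edges (graph_image G0 f))) f_inj) /=.
apply: eq_bigl => f; rewrite andbC; case: imsetP => [[i _ ->]|//].
by rewrite (f_ofP i).1.
Qed.

(** Bounds the number of ways in which a copy can meet a set of u edges: a set
    of edges of G0, and images of its vertices among at most 2 u vertices. *)
Definition overlap_count (u : nat) : R := 2 ^+ e0 * (2 * u).+1%:R ^+ v.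

Lemma overlap_count_ge0 u : 0 <= overlap_count u.
Proof. by rewrite mulr_ge0 ?exprn_ge0. Qed.

Lemma overlap_term_le (J : {set {set V}}) u : J \subset E0 -> J != finset.set0 ->
  ((2 * u) ^ #|finset.cover J| * n ^ (v - #|finset.cover J|))%:R * p ^+ (e0 - #|J|) <=
  (2 * u).+1%:R ^+ v * (A / psi).
Proof.
move=> JE J0; set c := #|finset.cover J|.
have covV : finset.cover J \subset V0.
  apply/fintype.subsetP => x /finset.bigcupP[e eJ].
  by apply: (fintype.subsetP (simple_sub simpleG0 (fintype.subsetP JE e eJ))).
have sJ : subgraph (finset.cover J, J) G0.
  apply/and3P; split => //; apply/forall_inP => e eJ /=.
  rewrite (simple_card simpleG0 (fintype.subsetP JE e eJ)) eqxx /=.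
  exact: finset.bigcup_sup.
have h := Psi_le sJ; rewrite /= card_gt0 in h; have {}h := h J0.
have cv : (c <= v)%N by exact: subset_leq_card.
have je : (#|J| <= e0)%N by exact: subset_leq_card.
rewrite natrM !natrX -mulrA; apply: ler_pM.
- by rewrite exprn_ge0.
- by rewrite mulr_ge0 ?exprn_ge0.
- apply: (@le_trans _ _ ((2 * u).+1%:R ^+ c)).
    by rewrite lerXn2r ?nnegrE// ler_nat.
  by rewrite ler_weXn2l ?ler1n.
rewrite ler_pdivlMr ?Psi_gt0//.
apply: (@le_trans _ _ (n%:R ^+ (v - c) * p ^+ (e0 - #|J|) * (n%:R ^+ c * p ^+ #|J|))).
  by rewrite ler_wpM2l// mulr_ge0 ?exprn_ge0.
by rewrite mulrACA -!exprD !subnK.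
Qed.

(** A copy that meets U is classified by the set J of edges of G0 that it sends
    into U: J spans a subgraph of G0, so fixing its vertices inside U costs at
    least the factor Psi. *)
Lemma sum_overlapping_copies u (U : {set {set 'I_n}}) : U \subset K -> (#|U| <= u)%N ->
  \sum_(i | meets (S i) U) p ^+ #|S i :\: U| <= overlap_count u * (A / psi).
Proof.
move=> UK Uu.
have U2 : {in U, forall d : {set 'I_n}, #|d| = 2%N}.
  by move=> d /(fintype.subsetP UK); rewrite inE => /eqP.
pose w X := if meets X U then p ^+ #|X :\: U| else 0.
have w0 X : 0 <= w X by rewrite /w; case: ifP => // _; rewrite exprn_ge0.
rewrite big_mkcond /=; apply: le_trans (sum_copies_le w0) _.
pose into (J : {set {set V}}) : {set {ffun V -> 'I_n}} :=
  [set f in @placements V m V0 | [forall e in J, f @: (e : {set V}) \in U]].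
pose good (J : {set {set V}}) := (J \subset E0) && (J != finset.set0).
apply: (@le_trans _ _ (\sum_(f | embedding G0 f) \sum_(J | good J)
    (f \in into J)%:R * p ^+ (e0 - #|J|))).
  apply: ler_sum => f fE; rewrite /w; case: ifP => [mU|_]; last first.
    by apply: sumr_ge0 => J _; rewrite mulr_ge0 ?exprn_ge0.
  have eI := imset_edges_inj simpleG0 (embedding_inj fE).
  pose J := [set e in E0 | f @: (e : {set V}) \in U].
  have JE : J \subset E0 by apply/fintype.subsetP => e; rewrite inE => /andP[].
  have imJ : edges (graph_image G0 f) :&: U = [set f @: (e : {set V}) | e in J].
    apply/setP => d; rewrite inE; apply/andP/imsetP => [[/imsetP[e eE ->] dU]|[e]].
      by exists e; rewrite // inE eE.
    by rewrite inE => /andP[eE dU] ->; split => //; rewrite imset_f.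
  have cJ : #|edges (graph_image G0 f) :\: U| = (e0 - #|J|)%N.
    rewrite cardsD imJ card_in_imset ?card_in_imset//.
    by apply: sub_in2 eI; exact: fintype.subsetP.
  have gJ : good J.
    rewrite /good JE /=; apply/eqP => J0; move: mU.
    by rewrite /meets -finset.setI_eq0 imJ J0 imset0 eqxx.
  rewrite cJ (bigD1 J) //= -[leLHS]addr0; apply: lerD; last first.
    by apply: sumr_ge0 => J' _; rewrite mulr_ge0 ?exprn_ge0.
  have -> : f \in into J.
    rewrite inE; apply/andP; split; first by case/andP: fE.
    by apply/forall_inP => e; rewrite inE => /andP[].
  by rewrite mul1r.
rewrite exchange_big /=.
apply: (@le_trans _ _ (\sum_(J | good J) (2 * u).+1%:R ^+ v * (A / psi))).
  apply: ler_sum => J /andP[JE J0]; rewrite -mulr_suml.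
  apply: le_trans (overlap_term_le u JE J0); rewrite ler_wpM2r ?exprn_ge0//.
  rewrite -natr_sum ler_nat.
  apply: leq_trans (card_placements_into simpleG0 JE U2 Uu).
  rewrite -sum1_card -/(into J) [in leqRHS]big_mkcond [in leqLHS]big_mkcond /=.
  by apply: leq_sum => f _; case: (embedding G0 f); case: (f \in into J).
rewrite sumr_const -[leLHS]mulr_natl /overlap_count -[leRHS]mulrA.
apply: ler_wpM2r; first by rewrite mulr_ge0 ?exprn_ge0// divr_ge0 ?mulr_ge0 ?exprn_ge0 ?(ltW Psi_gt0)// ltW.
rewrite -natrX ler_nat -card_powerset.
by apply: subset_leq_card; apply/fintype.subsetP => J /andP[JE _]; rewrite powersetE.
Qed.

Lemma sparse_copies :
  sparse K p predT S e0 A (fun u => overlap_count u * (A / psi)).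
Proof.
split.
- exact: copy_edges_sub.
- by move=> i; rewrite card_copy_edgesE.
- have w0 (X : {set {set 'I_n}}) : 0 <= p ^+ e0 by rewrite exprn_ge0.
  rewrite (eq_bigr (fun=> p ^+ e0)) => [|i _]; last by rewrite card_copy_edgesE.
  apply: le_trans (sum_copies_le w0) _.
  rewrite sumr_const -[leLHS]mulr_natl ler_wpM2r ?exprn_ge0//.
  rewrite -natrX -[n in (n ^ _)%N]/n -card_placements ler_nat.
  by apply: subset_leq_card; apply/fintype.subsetP => f /andP[].
- exact: sum_overlapping_copies.
Qed.

(** The covariance of the indicators of presence of two copies with edge sets
    X and Y. *)
Definition covariance (X Y : {set {set 'I_n}}) : R := p ^+ #|X :|: Y| - p ^+ (2 * e0).

Lemma covariance_ge0 (X Y : {set {set 'I_n}}) : #|X| = e0 -> #|Y| = e0 -> 0 <= covariance X Y.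
Proof.
move=> Xe Ye; rewrite subr_ge0 ler_wiXn2l//.
by apply: leq_trans (leq_card_setU _ _) _; rewrite Xe Ye; lia.
Qed.

Lemma covariance_ge (X Y : {set {set 'I_n}}) k : #|X| = e0 -> #|Y| = e0 -> (1 <= k)%N ->
  (k <= #|X :&: Y|)%N -> (1 - p) * p ^+ (2 * e0 - k) <= covariance X Y.
Proof.
move=> Xe Ye k1 kI; rewrite /covariance cardsU Xe Ye.
set l := #|X :&: Y| in kI *.
have le : (l <= e0)%N by rewrite -Xe subset_leq_card// finset.subsetIl.
have -> : p ^+ (2 * e0) = p ^+ l * p ^+ (e0 + e0 - l).
  by rewrite -exprD; congr (_ ^+ _); lia.
rewrite -[X in _ <= X - _]mul1r -mulrBl; apply: ler_pM.
- by rewrite subr_ge0.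
- by rewrite exprn_ge0.
- rewrite lerD2l lerN2 -[leRHS]expr1 ler_wiXn2l//; exact: leq_trans kI.
by rewrite ler_wiXn2l//; lia.
Qed.

Variable P : {set 'I_n} -> R.
Hypothesis P01 : forall d, 0 <= P d <= 1.
Hypothesis PK : {in K, forall d, P d = p}.

Lemma copy_sum_variance :
  Ex P (fun E => copy_sum p S E ^+ 2) = \sum_i \sum_j covariance (S i) (S j).
Proof.
have PS i : {in S i, forall d, P d = p}.
  by move=> d /(fintype.subsetP (copy_edges_sub i))/PK.
have -> : Ex P (fun E => copy_sum p S E ^+ 2) = \sum_i \sum_j Ex P (fun E =>
    (present R (S i) E - p ^+ e0) * (present R (S j) E - p ^+ e0)).
  under eq_bigr => i _ do rewrite -Ex_sum.
  rewrite -Ex_sum; apply: eq_Ex => E; rewrite expr2 /copy_sum mulr_suml.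
  apply: eq_bigr => i _; rewrite mulr_sumr; apply: eq_bigr => j _.
  by rewrite !card_copy_edgesE.
apply: eq_bigr => i _; apply: eq_bigr => j _.
transitivity (Ex P (fun E => present R (S i :|: S j) E - p ^+ e0 * present R (S i) E
   - p ^+ e0 * present R (S j) E + p ^+ e0 * p ^+ e0)).
  apply: eq_Ex => E; rewrite /present finset.subUset -mulnb natrM.
  move: (p ^+ e0) (nat_of_bool _)%:R (nat_of_bool _)%:R => a x y; ring.
rewrite ExD !ExB !ExZ Ex_cst !(Ex_present (p := p)) ?card_copy_edgesE//.
  rewrite /covariance mul2n -addnn (exprD p e0 e0).
  by move: (p ^+ e0) (p ^+ _) => a b; ring.
- exact: PS.
- exact: PS.
by move=> d; rewrite inE => /orP[]; exact: PS.
Qed.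

Lemma card_embeddings : (n ^_ v <= #|[set f : {ffun V -> 'I_n} | embedding G0 f]|)%N.
Proof.
pose ext (g : {ffun {x | x \in V0} -> 'I_n}) : {ffun V -> 'I_n} :=
  [ffun x => if insub x is Some u then g u else ord0].
have extE (g : {ffun {x | x \in V0} -> 'I_n}) (u : {x | x \in V0}) : ext g (val u) = g u by rewrite ffunE valK.
have ext_inj : injective ext.
  by move=> g g' gg'; apply/ffunP => u; rewrite -!extE gg'.
have -> : n ^_ v = #|ext @: [set g : {ffun {x | x \in V0} -> 'I_n} | injectiveb g]|.
  by rewrite card_imset // card_inj_ffuns card_ord card_sig.
apply: subset_leq_card; apply/fintype.subsetP => _ /imsetP[g gI ->].
move: gI; rewrite inE => /injectiveP gI.
rewrite inE; apply/andP; split.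
  by apply/placementsP => x xV; rewrite ffunE insubN.
apply/dinjectiveP => x y xV yV.
by rewrite -[x](SubK {x | x \in V0} xV) -[y](SubK {x | x \in V0} yV) !extE => /gI ->.
Qed.

Lemma sum_embeddings_le (w : graph 'I_n -> R) : (forall H, 0 <= w H) ->
  \sum_(f | embedding G0 f) w (graph_image G0 f) <=
  (v ^ v)%:R * \sum_(i : copy_type) w (val i).
Proof.
move=> w0; rewrite -(big_sub (copies G0 m) w).
rewrite (partition_big (@graph_image _ G0 m) (mem (copies G0 m))) /=; last first.
  by move=> f; exact: graph_image_copy.
rewrite mulr_sumr; apply: ler_sum => H HC.
rewrite (eq_bigr (fun=> w H)) => [|f /andP[_ /eqP->]//].
rewrite sumr_const -[leLHS]mulr_natl ler_wpM2r// ler_nat.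
have -> : (v ^ v)%N = #|pffun_on (ord0 : 'I_n) (mem V0) (mem (vertices H))|.
  by rewrite card_pffun_on (card_copy_vertices simpleG0 HC).
apply: subset_leq_card; apply/fintype.subsetP => f /andP[/andP[fV _] /eqP fH].
apply/pffun_onP; split => [|_ /fintype.imageP[x xV ->]]; last by rewrite -fH imset_f.
apply/fintype.subsetP => x; apply: contraLR => /(placementsP _ _ fV) fx.
by rewrite inE fx eqxx.
Qed.

Definition restrict (X : {set V}) (f : {ffun V -> 'I_n}) : {ffun V -> 'I_n} :=
  [ffun x => if x \in X then f x else ord0].

(** Grouping the embeddings by their restriction to X, Cauchy--Schwarz shows
    that many pairs have the same restriction. *)
Lemma embedding_pairs_ge (X : {set V}) :
  (n ^_ v)%:R ^+ 2 <= n%:R ^+ #|X| *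
  \sum_(f | embedding G0 f) \sum_(g | embedding G0 g && (restrict X g == restrict X f)) 1 :> R.
Proof.
pose N (r : {ffun V -> 'I_n}) : R := \sum_(f | embedding G0 f && (restrict X f == r)) 1.
have rX f : embedding G0 f -> restrict X f \in @placements V m X.
  by move=> _; apply/placementsP => x /negbTE xX; rewrite ffunE xX.
have -> : \sum_(f | embedding G0 f) \sum_(g | embedding G0 g && (restrict X g == restrict X f)) 1
    = \sum_(r in @placements V m X) N r ^+ 2.
  rewrite (partition_big (restrict X) (mem (@placements V m X)))//=.
  apply: eq_bigr => r _; rewrite (eq_bigr (fun=> N r)) => [|f /andP[_ /eqP->]//].
  by rewrite expr2 {2}/N mulr_suml; apply: eq_bigr => f _; rewrite mul1r.
rewrite -[in leRHS]natrX -(@card_placements V m X); apply: le_trans (sqr_sum_le _ _).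
rewrite lerXn2r ?nnegrE//; first by apply: sumr_ge0 => r _; apply: sumr_ge0.
rewrite -(partition_big (restrict X) (mem (@placements V m X)))//=.
rewrite sumr_const ler_nat; apply: leq_trans card_embeddings _.
by rewrite cardsE.
Qed.

(** Copies that share the subgraph at which Psi is attained are positively
    correlated, and there are enough of them. *)
Lemma copy_sum_variance_ge : (v <= n)%N ->
  ((v ^ v)%:R ^+ 4)^-1 * ((1 - p) * A * (A / psi)) <=
  Ex P (fun E => copy_sum p S E ^+ 2).
Proof.
move=> vn; rewrite copy_sum_variance.
have [H /andP[/and3P[sH HV HE] H1] ->] := Psi_attained.
set X := vertices H; set k := #|edges H|.
have vv0 : 0 < (v ^ v)%:R :> R.
  rewrite ltr0n expn_gt0; have [x xV] := exists_vertex simpleG0 edgeG0.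
  by apply/orP; left; apply/card_gt0P; exists x.
have cov0 (F F' : graph 'I_n) : F \in copies G0 m -> F' \in copies G0 m ->
    0 <= covariance (edges F) (edges F').
  by move=> FC FC'; apply: covariance_ge0; exact: (card_copy_edges simpleG0).
pose w (F F' : graph 'I_n) : R :=
  if (F \in copies G0 m) && (F' \in copies G0 m) then covariance (edges F) (edges F') else 0.
have w0 F F' : 0 <= w F F' by rewrite /w; case: ifP => // /andP[? ?]; exact: cov0.
pose pairs : R := \sum_(f | embedding G0 f)
  \sum_(g | embedding G0 g && (restrict X g == restrict X f)) 1.
have low : (1 - p) * p ^+ (2 * e0 - k) * pairs <=
    (v ^ v)%:R * ((v ^ v)%:R * \sum_i \sum_j covariance (S i) (S j)).
  apply: (@le_trans _ _ (\sum_(f | embedding G0 f) \sum_(g | embedding G0 g)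
      w (graph_image G0 f) (graph_image G0 g))).
    rewrite mulr_sumr; apply: ler_sum => f fE; rewrite mulr_sumr big_mkcondr /=.
    apply: ler_sum => g gE; case: ifP => // /eqP fg; rewrite mulr1.
    rewrite /w !(graph_image_copy simpleG0 edgeG0)//=.
    have cE h : embedding G0 h -> #|edges (graph_image G0 h)| = e0.
      by move=> hE; apply: (card_copy_edges simpleG0); exact: graph_image_copy.
    apply: covariance_ge; rewrite ?cE//.
    have eI := imset_edges_inj simpleG0 (embedding_inj fE).
    have -> : k = #|[set f @: (e : {set V}) | e in edges H]|.
      by rewrite card_in_imset//; apply: sub_in2 eI; exact: fintype.subsetP.
    apply: subset_leq_card; apply/fintype.subsetP => _ /imsetP[e eH ->].
    have eE := fintype.subsetP HE _ eH.
    rewrite inE imset_f//=; apply/imsetP; exists e => //.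
    apply: eq_in_imset => x xe.
    have xX := fintype.subsetP (simple_sub sH eH) _ xe.
    by move/ffunP/(_ x): fg; rewrite !ffunE xX.
  apply: (@le_trans _ _ (\sum_(f | embedding G0 f) (v ^ v)%:R *
      \sum_(j : copy_type) w (graph_image G0 f) (val j))).
    by apply: ler_sum => f _; apply: (sum_embeddings_le (w := w (graph_image G0 f))).
  rewrite -mulr_sumr ler_wpM2l//.
  apply: le_trans (sum_embeddings_le (w := fun F => \sum_(j : copy_type) w F (val j)) _) _.
    by move=> F; apply: sumr_ge0.
  rewrite ler_wpM2l//; apply: ler_sum => i _; apply: ler_sum => j _.
  by rewrite /w (valP i) (valP j).
have ffn : n%:R ^+ v <= (n ^_ v)%:R * (v ^ v)%:R :> R.
  by rewrite -natrM -natrX ler_nat ffact_ge.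
have pr := embedding_pairs_ge X; rewrite -/pairs in pr.
have q0 : 0 <= 1 - p by rewrite subr_ge0.
set vv := (v ^ v)%:R in vv0 low ffn *; set Vr := \sum_i _ in low *.
have k2e : (k <= e0)%N by exact: subset_leq_card.
have h1 : n%:R ^+ v * n%:R ^+ v <= n%:R ^+ #|X| * pairs * vv ^+ 2.
  rewrite -expr2; apply: (@le_trans _ _ (((n ^_ v)%:R * vv) ^+ 2)).
    by rewrite lerXn2r ?nnegrE ?mulr_ge0 ?exprn_ge0// ltW.
  by rewrite exprMn ler_wpM2r// sqr_ge0.
have nX : 0 < n%:R ^+ #|X| :> R by rewrite exprn_gt0.
have pk : 0 < p ^+ k by rewrite exprn_gt0.
rewrite mulrC ler_pdivrMr ?exprn_gt0//.
have -> : (1 - p) * A * (A / (n%:R ^+ #|X| * p ^+ k)) =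
    (1 - p) * p ^+ (2 * e0 - k) * ((n%:R ^+ v * n%:R ^+ v) / n%:R ^+ #|X|).
  rewrite (expr_double_sub (lt0r_neq0 p_gt0) k2e).
  move: (p ^+ e0) (p ^+ k) (n%:R ^+ v) (n%:R ^+ #|X|) pk nX => a b c d b0 d0.
  by field; rewrite !gt_eqF.
apply: (@le_trans _ _ ((1 - p) * p ^+ (2 * e0 - k) * (pairs * vv ^+ 2))).
  apply: ler_wpM2l; first by rewrite mulr_ge0 ?exprn_ge0.
  by rewrite ler_pdivrMr// [leRHS]mulrC [leRHS]mulrA; exact: h1.
rewrite mulrA (_ : Vr * vv ^+ 4 = (vv * (vv * Vr)) * vv ^+ 2); last by ring.
by rewrite ler_wpM2r ?sqr_ge0.
Qed.

End CopiesInTheRandomGraph.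

(** * Subgraph counts *)

Section RandomGraph.
Variables (R : realType) (n : nat) (p : R).
Hypothesis p01 : 0 <= p <= 1.

(** The probability that a set of vertices is an edge: making the sets that are
    not edges of the complete graph impossible lets the edge sets range over
    all sets of sets of vertices. *)
Definition edge_prob (d : {set 'I_n}) : R := if d \in complete_edges n then p else 0.

Lemma edge_prob01 d : 0 <= edge_prob d <= 1.
Proof. by rewrite /edge_prob; case: ifP; rewrite ?lexx ?ler01. Qed.

Lemma edge_probE : {in complete_edges n, forall d, edge_prob d = p}.
Proof. by move=> d dK; rewrite /edge_prob dK. Qed.

Lemma gnp_weightE (E : {set {set 'I_n}}) : E \subset complete_edges n ->
  gnp_weight p E = weight edge_prob E.
Proof.
move=> EK; rewrite /weight (bigID (mem (complete_edges n))) /= [X in _ * X]big1 ?mulr1.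
  by apply: eq_bigr => d dK; rewrite edge_probE.
move=> d dK; rewrite /edge_prob (negbTE dK) subr0; case: ifP => // dE.
by rewrite (fintype.subsetP EK _ dE) in dK.
Qed.

Lemma weight_eq0 (E : {set {set 'I_n}}) : ~~ (E \subset complete_edges n) ->
  weight edge_prob E = 0.
Proof.
move=> /fintype.subsetPn[d dE dK]; rewrite /weight (bigD1 d) //= dE.
by rewrite /edge_prob (negbTE dK) mul0r.
Qed.

Lemma gnp_expectationE (X : graph 'I_n -> R) :
  gnp_expectation p X = Ex edge_prob (fun E => X ([set: 'I_n], E)).
Proof.
rewrite /gnp_expectation /Ex [RHS](bigID (mem (powerset (complete_edges n)))) /=.
rewrite [X in _ + X]big1 ?addr0 => [|E]; last first.
  by rewrite powersetE => /weight_eq0 ->; rewrite mul0r.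
by apply: eq_bigr => E; rewrite powersetE => /gnp_weightE ->.
Qed.

Lemma gnp_probE (A : graph 'I_n -> bool) :
  gnp_prob p A = gnp_expectation p (fun G => (A G)%:R).
Proof.
rewrite /gnp_prob /gnp_expectation big_mkcondr /=; apply: eq_bigr => E _.
by case: (A _); rewrite ?mulr1 ?mulr0.
Qed.

End RandomGraph.

Section SubgraphCount.
Variables (R : realType) (V : finType) (G0 : graph V).
Hypothesis simpleG0 : simple_graph G0.
Hypothesis edgeG0 : (1 <= #|edges G0|)%N.

Lemma countW_ord0 (G : graph 'I_0) : countW R G0 G = 0.
Proof.
rewrite /countW /subgraph_count (_ : [set H | _] = finset.set0) ?cards0//.
apply/setP => H; rewrite !inE; apply/negbTE/negP => /andP[_ /existsP[f /and3P[_ /eqP fV _]]].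
have [x] := exists_vertex simpleG0 edgeG0; rewrite -fV => /imsetP[y _ _].
by have := ltn_ord y.
Qed.

Variables (m : nat) (p : R).
Hypothesis p01 : 0 <= p <= 1.
Local Notation n := m.+1.
Local Notation P := (edge_prob (n := n) p).
Local Notation S := (copy_edges (G0 := G0) (m := m)).

Lemma countWE (E : {set {set 'I_n}}) :
  countW R G0 ([set: 'I_n], E) = \sum_i present R (S i) E.
Proof.
rewrite /countW /subgraph_count.
have -> : \sum_i present R (S i) E =
    \sum_(i : copy_type G0 m) (fun H : graph 'I_n => (edges H \subset E)%:R) (val i) by [].
rewrite -(big_sub (copies G0 m) (fun H : graph 'I_n => (edges H \subset E)%:R)).
rewrite -natr_sum -sum1_card; congr _%:R.
rewrite big_mkcond [RHS]big_mkcond; apply: eq_bigr => H _; rewrite !inE /subgraph /=.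
rewrite finset.subsetT /=.
by case: (simple_graph H); case: (isomorphic H G0); case: (edges H \subset E).
Qed.

Lemma countW_centered (E : {set {set 'I_n}}) :
  countW R G0 ([set: 'I_n], E) - gnp_expectation p (countW R G0 (n := n)) =
  copy_sum p S E.
Proof.
rewrite gnp_expectationE countWE.
rewrite (_ : Ex _ _ = \sum_i p ^+ #|S i|) -?sumrB//.
under eq_Ex => F do rewrite countWE.
rewrite Ex_sum; apply: eq_bigr => i _; rewrite (Ex_present (p := p))//.
move=> d dS; apply: edge_probE; exact: (fintype.subsetP (copy_edges_sub i)).
Qed.

Lemma gnp_varianceE :
  gnp_variance p (countW R G0 (n := n)) = Ex P (fun E => copy_sum p S E ^+ 2).
Proof.
by rewrite /gnp_variance gnp_expectationE; apply: eq_Ex => E; rewrite countW_centered.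
Qed.

Lemma gnp_standardizeE (E : {set {set 'I_n}}) :
  gnp_standardize p (countW R G0 (n := n)) ([set: 'I_n], E) = std_copy_sum p P S E.
Proof. by rewrite /gnp_standardize countW_centered gnp_varianceE. Qed.

Lemma gnp_prob_standardizeE z :
  gnp_prob p (fun G => gnp_standardize p (countW R G0 (n := n)) G <= z) =
  Ex P (fun E => (std_copy_sum p P S E <= z)%R%:R).
Proof.
by rewrite gnp_probE gnp_expectationE; apply: eq_Ex => E; rewrite gnp_standardizeE.
Qed.

(** Without copies, or for p = 0 or p = 1, the count is almost surely
    constant. *)
Lemma variance_gt0_range : 0 < gnp_variance p (countW R G0 (n := n)) ->
  [/\ 0 < p, p < 1 & (#|vertices G0| <= n)%N].
Proof.
rewrite gnp_varianceE (copy_sum_variance simpleG0 (edge_probE (n := n) p)) => V0.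
have [i /eqP]: exists i : copy_type G0 m, \sum_j covariance G0 p (S i) (S j) != 0.
  apply/existsP; apply: contraTT V0 => /existsPn h.
  by rewrite big1 ?ltxx// => i _; apply/eqP/negPn/h.
move=> cov_i; have [p_ge0 p_le1] := andP p01.
have pn0 : p != 0.
  apply/eqP => p0; apply: cov_i; rewrite big1 // => j _; rewrite /covariance p0.
  rewrite !expr0n; have -> : #|S i :|: S j| == 0%N = false.
    apply/negbTE; rewrite -lt0n; apply: leq_trans edgeG0 _.
    by rewrite -(card_copy_edgesE simpleG0 i) subset_leq_card// finset.subsetUl.
  by rewrite muln_eq0 /= -leqn0 leqNgt edgeG0 subrr.
have pn1 : p != 1.
  apply/eqP => p1; apply: cov_i; rewrite big1 // => j _.
  by rewrite /covariance p1 !expr1n subrr.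
split; [by rewrite lt_neqAle eq_sym pn0|by rewrite lt_neqAle pn1|].
rewrite -(card_copy_vertices simpleG0 (valP i)).
by rewrite -[X in (_ <= X)%N](card_ord n) max_card.
Qed.

Section Bounds.
Hypothesis variance_gt0 : 0 < gnp_variance p (countW R G0 (n := n)).
Variable z : R.
Local Notation L := #|edges G0|.
Local Notation cb := (overlap_count R G0).
Local Notation c0 := (((#|vertices G0| ^ #|vertices G0|)%:R ^+ 4)^-1 : R).
Local Notation A := (n%:R ^+ #|vertices G0| * p ^+ #|edges G0| : R).
Local Notation psi := (Psi G0 n p).
Local Notation deviation := `| gnp_prob p (fun G =>
  gnp_standardize p (countW R G0 (n := n)) G <= z) - Phi z |.

Let p_gt0 : 0 < p. Proof. by have [] := variance_gt0_range variance_gt0. Qed.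
Let p_lt1 : p < 1. Proof. by have [] := variance_gt0_range variance_gt0. Qed.
Let vn : (#|vertices G0| <= n)%N.
Proof. by have [] := variance_gt0_range variance_gt0. Qed.
Let psi_gt0 : 0 < psi. Proof. exact: Psi_gt0. Qed.
Let A_gt0 : 0 < A. Proof. by rewrite mulr_gt0 ?exprn_gt0 ?ltr0n. Qed.
Let B_gt0 : 0 < A / psi. Proof. exact: divr_gt0. Qed.
Let c0_gt0 : 0 < c0.
Proof.
rewrite invr_gt0 exprn_gt0// ltr0n expn_gt0; apply/orP; left.
by apply/card_gt0P; exact: exists_vertex simpleG0 edgeG0.
Qed.
Let spS := sparse_copies simpleG0 edgeG0 m p_gt0.
Let V_ge := copy_sum_variance_ge simpleG0 edgeG0 p_gt0 (ltW p_lt1)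
  (edge_probE (n := n) p) vn.
Let q_gt0 : 0 < 1 - p. Proof. by rewrite subr_gt0. Qed.

Lemma defect_ratioE : defect_ratio p A (A / psi) = ((1 - p) * psi)^-1.
Proof.
rewrite /defect_ratio invfM; move: A psi A_gt0 psi_gt0 => a b a0 b0.
by field; rewrite !gt_eqF.
Qed.

Lemma sqrt_defect_ratio :
  Num.sqrt (defect_ratio p A (A / psi)) = (Num.sqrt ((1 - p) * psi))^-1.
Proof. by rewrite defect_ratioE sqrtrV// mulr_ge0// ltW. Qed.

Definition even_moment_const (k : nat) (c : R) : R :=
  if k is j.+1 then moment_const L cb c0 j * (cb L + c^-1) ^+ j else 1.

Lemma deviation_le_large k c Ck : 0 < c -> c <= (1 - p) * psi ->
  (forall w, `|w| <= `|z| / 2 -> stein_size z w <= Ck / (1 + `|z|) ^+ k) ->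
  deviation <=
  (Ck ^+ 2 + 4 * (2 ^+ (2 * k) * (1 + 2 ^+ (2 * k) * even_moment_const k c)) +
   deviation_const L cb c0) / (1 + `|z|) ^+ k * (Num.sqrt ((1 - p) * psi))^-1.
Proof.
move=> c_gt0 cq hC; rewrite gnp_prob_standardizeE -sqrt_defect_ratio.
have cb0 := overlap_count_ge0 R G0.
apply: (stein_bound_moment (ltW p_gt0) p_lt1 (edge_prob01 p01)
  (edge_probE (n := n) p) spS A_gt0 B_gt0 cb0 c0_gt0 V_ge hC).
case: k hC => [|j] _.
  by under eq_Ex => E do rewrite muln0 expr0; rewrite Ex_cst.
apply: le_trans (std_moment (ltW p_gt0) p_lt1 (edge_prob01 p01)
  (edge_probE (n := n) p) spS A_gt0 B_gt0 cb0 c0_gt0 V_ge j) _.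
apply: ler_wpM2l; first exact: moment_const_ge0.
have q0 : 0 < (1 - p) * psi by rewrite mulr_gt0.
rewrite defect_ratioE lerXn2r ?nnegrE ?addr_ge0 ?invr_ge0 ?(ltW q0) ?(ltW c_gt0)//.
by rewrite lerD2l lef_pV2 ?posrE.
Qed.

Lemma deviation_le_small C3 : (1 - p) * psi <= 1 ->
  (forall w, `|w| <= `|z| / 2 -> `|(w <= z)%R%:R - Phi z| <= C3 / (1 + `|z|) ^+ 3) ->
  deviation <= (C3 + 8 + 32 + 32 * (moment_const L cb c0 1 * (cb L + 1))) /
    (1 + `|z|) ^+ 3 * (Num.sqrt ((1 - p) * psi))^-1.
Proof.
move=> q1 hC; rewrite gnp_prob_standardizeE -sqrt_defect_ratio.
apply: (third_moment_bound (ltW p_gt0) p_lt1 (edge_prob01 p01)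
  (edge_probE (n := n) p) spS A_gt0 B_gt0 (overlap_count_ge0 R G0)
  c0_gt0 V_ge _ hC).
by rewrite defect_ratioE invf_ge1// mulr_gt0.
Qed.

End Bounds.
End SubgraphCount.

Lemma weaken_bound (R : realType) (a b C z s : R) (k l : nat) : (k <= l)%N ->
  0 <= s -> 0 <= C -> a <= b / (1 + `|z|) ^+ l * s -> b <= C -> a <= C / (1 + `|z|) ^+ k * s.
Proof.
move=> kl s0 C0 ab bC; apply: le_trans ab _; rewrite ler_wpM2r//.
have z1 : 1 <= 1 + `|z| by rewrite lerDl.
have z0 j : 0 < (1 + `|z|) ^+ j by rewrite exprn_gt0// (lt_le_trans ltr01).
apply: (@le_trans _ _ (C / (1 + `|z|) ^+ l)).
  by rewrite ler_wpM2r// invr_ge0 ltW.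
by rewrite ler_wpM2l// lef_pV2 ?posrE// ler_weXn2l.
Qed.

(* The error term is an O(.) as (q * Psi)^(-1/2) tends to 0, so the constant is
   uniform over each range c <= q * Psi. This lower bound is required only for
   3 < k: the estimate without it fails then (take p -> 0 with n fixed). *)
Theorem theorem5p7 (R : realType) (V : finType) (G0 : graph V)
    (simpleG0 : simple_graph G0) (edgeG0 : (1 <= #|edges G0|)%N)
    (k : nat) (c : R) (c_gt0 : 0 < c) :
  exists C : R, 0 < C /\
    forall (n : nat) (p z : R),
      0 <= p <= 1 ->
      0 < gnp_variance p (@countW R V G0 n) ->
      ((3 < k)%N -> c <= (1 - p) * Psi G0 n p) ->
      `| gnp_prob p (fun G => gnp_standardize p (@countW R V G0 n) G <= z)
         - Phi z |
      <= C / (1 + `|z|) ^+ k * (Num.sqrt ((1 - p) * Psi G0 n p))^-1.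
Proof.
have [C3 C3_gt0 h3] := @Phi_tail R 3.
have [C1 C1_gt0 h1] := @stein_size_tail R k.
pose cb := overlap_count R G0.
pose c0 : R := ((#|vertices G0| ^ #|vertices G0|)%:R ^+ 4)^-1.
(* q Psi < 1 is left to the moment bound when k <= 3 *)
pose cl := if (3 < k)%N then c else 1.
have cl_gt0 : 0 < cl by rewrite /cl; case: ifP.
pose Clarge := C1 ^+ 2 + 4 * (2 ^+ (2 * k) *
  (1 + 2 ^+ (2 * k) * even_moment_const G0 k cl)) +
  deviation_const #|edges G0| cb c0.
pose Csmall := C3 + 8 + 32 + 32 * (moment_const #|edges G0| cb c0 1 * (cb #|edges G0| + 1)).
exists (1 + `|Clarge| + `|Csmall|); split.
  by rewrite -addrA ltr_wpDr// addr_ge0.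
move=> [|m] p z p01 V_gt0 hk.
  (* on no vertices there are no copies, and the variance vanishes *)
  exfalso; move: V_gt0; rewrite /gnp_variance gnp_expectationE.
  rewrite (_ : Ex _ _ = 0) ?ltxx// -[RHS](Ex_cst (edge_prob (n := 0) p) 0).
  apply: eq_Ex => E; rewrite countW_ord0// gnp_expectationE.
  under eq_Ex => F do rewrite countW_ord0//.
  by rewrite Ex_cst subrr expr0n.
have [large|small] := leP cl ((1 - p) * Psi G0 m.+1 p).
  have := deviation_le_large simpleG0 edgeG0 p01 V_gt0 cl_gt0 large (h1 z).
  move=> /(weaken_bound (leqnn k)); apply.
  - by rewrite invr_ge0 sqrtr_ge0.
  - by rewrite !addr_ge0.
  - rewrite -[leLHS]/Clarge; have := ler_norm Clarge; have := normr_ge0 Csmall.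
    by move: Clarge Csmall => a b; lra.
have k3 : (k <= 3)%N.
  rewrite leqNgt; apply/negP => k3; move: small; rewrite /cl k3.
  by rewrite ltNge (hk k3).
have {}small : (1 - p) * Psi G0 m.+1 p <= 1.
  by move: small; rewrite /cl ltnNge k3 => /ltW.
have := deviation_le_small simpleG0 edgeG0 p01 V_gt0 small (h3 z).
move=> /(weaken_bound k3); apply.
- by rewrite invr_ge0 sqrtr_ge0.
- by rewrite !addr_ge0.
- rewrite -[leLHS]/Csmall; have := ler_norm Csmall; have := normr_ge0 Clarge.
  by move: Clarge Csmall => a b; lra.
Qed.
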